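(* Fix $\gamma\in\mathbb R$ and fixed $\alpha>1$. Suppose $(\log n)^2\ll k\ll\sqrt n$ and $m=\frac{k^2n}{4\log n}\big(1+\frac{\gamma}{\sqrt{\log n}}\big)$ (rounded to an integer). Let $A=\{\Lambda(G)\ge1\}$ and $B=\{\Delta(G)\ge t^*\}$. Then the symmetric difference $A\triangle B$ satisfies $\mathbb P_0(A\triangle B)=o(1)$ and $\mathbb P_1(A\triangle B)=o(1)$.
   Context: Let $n,m,k$ be positive integers and $N=\binom n2$; all asymptotics are as $n\to\infty$ with $k=k(n)$, $m=m(n)$, and $a\ll b$ means $a/b\to0$. The null distribution $\mathbb P_0$ is the Erdős–Rényi model $G(n,m)$: the uniform distribution over graphs on vertex set $[n]$ with exactly $m$ edges. The planted distribution $\mathbb P_1$ is the law of the random graph obtained as follows: choose a hub vertex $v_*\in[n]$ uniformly at random; choose a uniformly random set $S$ of $k$ of the $n-1$ possible edges incident to $v_*$; then choose a uniformly random set of $m-k$ edges among the $N-k$ possible edges not in $S$; the graph consists of these $m$ edges. $\Lambda(G)=\frac{d\mathbb P_1}{d\mathbb P_0}(G)$ is the likelihood ratio and $\Delta(G)$ the maximum degree of $G$. For a fixed $\alpha>0$, the threshold is $$t^*=\frac{2m}{n}+\sqrt{\frac{2m}{n}\Big(1-\frac mN\Big)}\sqrt{2\log n-\frac1\alpha\log\log n}.$$ *)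

(* Defs.v *)
From HB Require Import structures.
From mathcomp Require Import all_boot all_order all_algebra.
From mathcomp Require Import all_classical all_reals all_analysis.
Unset Printing Implicit Defensive.
Import Order.TTheory GRing.Theory Num.Theory.
Local Open Scope ring_scope.

Notation graph n := {set {set 'I_n}}.

Definition edges (n : nat) : graph n := [set e : {set 'I_n} | #|e| == 2%N].

Definition is_graph (n m : nat) (G : graph n) : bool :=
  (G \subset edges n) && (#|G| == m).

Definition star (n : nat) (v : 'I_n) : graph n := [set e in edges n | v \in e].

Definition NN (n : nat) : nat := 'C(n, 2).

Definition P0 (R : realType) (n m : nat) (G : graph n) : R :=
  if is_graph n m G then ('C(NN n, m))%:R^-1 else 0.

(* Planted distribution: hub v uniform, S uniform k-subset of star v,
   then a uniform (m-k)-subset T of the N-k edges not in S; G = S :|: T.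
   Given (v,S), G arises iff S \subset G and G is a graph with m edges,
   and then T = G :\: S is one of 'C(N-k, m-k) equally likely choices. *)
Definition P1 (R : realType) (n m k : nat) (G : graph n) : R :=
  \sum_(v : 'I_n)
    \sum_(S : graph n | (S \subset star n v) && (#|S| == k))
      ((n%:R)^-1 * ('C(n.-1, k))%:R^-1 *
        (if (S \subset G) && is_graph n m G
         then ('C(NN n - k, m - k))%:R^-1 else 0)).

Definition Prob (R : realType) (n : nat) (P : graph n -> R) (E : pred (graph n)) : R :=
  \sum_(G : graph n | E G) P G.

Definition Lambda (R : realType) (n m k : nat) (G : graph n) : R :=
  P1 R n m k G / P0 R n m G.

Definition degree (n : nat) (G : graph n) (v : 'I_n) : nat :=
  #|[set e in G | v \in e]|.

Definition maxdeg (n : nat) (G : graph n) : nat :=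
  \max_(v : 'I_n) degree n G v.

Definition tstar (R : realType) (alpha : R) (n m : nat) : R :=
  2 * m%:R / n%:R
  + Num.sqrt (2 * m%:R / n%:R * (1 - m%:R / (NN n)%:R))
    * Num.sqrt (2 * ln (n%:R : R) - alpha^-1 * ln (ln (n%:R : R))).

Definition symdiffAB (R : realType) (alpha : R) (n m k : nat) : pred (graph n) :=
  fun G => (1 <= Lambda R n m k G) != ((maxdeg n G)%:R >= tstar R alpha n m).

Definition m_target (R : realType) (gamma : R) (n k : nat) : R :=
  (k%:R ^+ 2 * n%:R / (4 * ln (n%:R : R))) * (1 + gamma / Num.sqrt (ln (n%:R : R))).

(* Main.v *)
Require Import Defs.
From HB Require Import structures.
From mathcomp Require Import all_boot all_order all_algebra.
From mathcomp Require Import all_classical all_reals all_analysis.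
From mathcomp Require Import fintype finset.
From mathcomp Require Import zify ring lra.
Import Order.TTheory GRing.Theory Num.Theory.
Import numFieldNormedType.Exports.
Local Open Scope ring_scope.

Set Implicit Arguments.
Unset Strict Implicit.

(** Write [D = 2m/n], [s = sqrt D] and let [J] be the least integer above the threshold.
    Conditioning on the hub shows that [Lambda] is the average over the vertices [v] of
    [lam (degree v)], where [lam] is the ratio of the degree law of the hub to the null
    degree law [pdeg].

    If the maximal degree reaches [J] while [Lambda < 1], both probabilities are bounded by
    the null probability that some degree reaches [J]. If all degrees are below [J] while
    [Lambda >= 1], then the truncated average [Ltr] of [lam] over the degrees below [J] is at
    least [1], whereas its null mean [csum] is the probability that the hub degree is below [J].
    Since [J - D - k = O(s)], this mean is bounded away from [1], and Chebyshev's inequality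
    applies: degrees of distinct vertices are nearly independent, so the variance of [Ltr]
    is at most [lam J / n + o(1)].

    Finally [lam J = n (log n)^(-1/(2 alpha))] up to a constant factor. So [lam J / n] tends
    to [0]; and since the mass of the hub degree at [J] is [O(1/s)], the expected number of
    vertices of null degree at least [J] is [O((log n)^((1/alpha - 1)/2))]. *)

(** Truncation is forced. Here [k^2/D] is about [2 log n], and squaring [lam] moves its null weight
    to degrees near [D + 2k], far above the threshold, so the plain second moment of [Lambda]
    diverges. The prescribed [m] is the critical one: [k^2 = 2 D log n] up to a relative error
    [O(1/sqrt (log n))], so the shift [k] of the hub degree agrees up to [O(s)] with the excess over
    [D] of the largest null degree. At this scale no limit law is needed: it is enough to compare
    consecutive weights of the hub degree law. Null probabilities near [J] are never estimated by
    Stirling's formula. The null mass at [J] is the hub mass at [J] divided by [lam J], and [lam J]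
    is a product of [k] factors close to [1]. The two conditions on [k] act separately:
    [(log n)^2 << k] keeps the second-order term [k^3/D^2] of [log (lam J)] bounded, while
    [k << sqrt n] gives [D log n <= n], which makes the correlation of two degrees vanish. The
    hypothesis [alpha > 1] serves only to make the expected number of vertices reaching [J] tend to
    [0]. *)

(** * Counting graphs with prescribed degrees at one or two vertices *)

Lemma card_subset_split (T : finType) (A B : {set T}) (P Q : pred {set T}) :
  [disjoint A & B] ->
  #|[set G : {set T} | [&& G \subset A :|: B, P (G :&: A) & Q (G :&: B)]]|
  = (#|[set X : {set T} | (X \subset A) && P X]|
     * #|[set Y : {set T} | (Y \subset B) && Q Y]|)%N.
Proof.
move=> dAB.
have IA (X Y : {set T}) : X \subset A -> Y \subset B -> (X :|: Y) :&: A = X.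
  move=> XA YB; rewrite setIUl (setIidPl XA).
  suff -> : Y :&: A = set0 by rewrite setU0.
  apply/eqP; rewrite setI_eq0 disjoint_sym.
  exact: disjointWr YB dAB.
have IB (X Y : {set T}) : X \subset A -> Y \subset B -> (X :|: Y) :&: B = Y.
  move=> XA YB; rewrite setIUl (setIidPl YB).
  suff -> : X :&: B = set0 by rewrite set0U.
  apply/eqP; rewrite setI_eq0.
  exact: disjointWl XA dAB.
rewrite -cardsX -(@card_in_imset _ _ (fun u : {set T} * {set T} => u.1 :|: u.2)); last first.
  move=> [X Y] [X' Y']; rewrite !inE /= => /andP[/andP[XA _] /andP[YB _]].
  move=> /andP[/andP[XA' _] /andP[YB' _]] e.
  by rewrite -(IA X Y) // e IA // -[in LHS](IB X Y) // e IB.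
congr (#|pred_of_set _|); apply/setP => G; rewrite !inE.
apply/idP/imsetP.
  move=> /and3P[GAB PA QB]; exists (G :&: A, G :&: B).
    by rewrite !inE /= !subsetIr PA QB.
  by rewrite /= -setIUr (setIidPl GAB).
move=> [[X Y]]; rewrite !inE /= => /andP[/andP[XA PX] /andP[YB QY]] ->.
by rewrite IA // IB // PX QY setUSS.
Qed.

Lemma card_edges n : #|edges n| = NN n.
Proof. by rewrite /edges card_draws card_ord. Qed.

Lemma star_sub n v : star n v \subset edges n.
Proof. by apply/subsetP => e; rewrite inE => /andP[]. Qed.

Lemma in_star n v e : (e \in star n v) = (#|e| == 2) && (v \in e).
Proof. by rewrite !inE. Qed.

Lemma card_star n (v : 'I_n) : #|star n v| = n.-1.
Proof.
have -> : star n v = [set [set v; u] | u in [set~ v]].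
  apply/setP => e; rewrite in_star; apply/idP/imsetP.
    move=> /andP[/cards2P[x [y [xy ->]]]]; rewrite !inE => /orP[] /eqP ->.
      by exists y => //; rewrite !inE eq_sym.
    by exists x; rewrite ?inE // setUC.
  by move=> [u]; rewrite !inE => uv ->; rewrite cards2 !inE eqxx (eq_sym v) uv.
rewrite card_in_imset ?cardsC1 ?card_ord // => x y; rewrite !inE => xv yv e.
have : x \in [set v; y] by rewrite -e !inE eqxx orbT.
by rewrite !inE (negbTE xv) => /eqP.
Qed.

Lemma degreeE n (G : graph n) v : G \subset edges n ->
  degree n G v = #|G :&: star n v|.
Proof.
move=> /subsetP GE; rewrite /degree; congr (#|pred_of_set _|); apply/setP => e.
rewrite [LHS]inE [RHS]inE in_star; case eG : (e \in G) => //=.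
have h : #|e| == 2 by have := GE e eG; rewrite /edges inE.
by rewrite h.
Qed.

Lemma degree_lt n (G : graph n) v : G \subset edges n -> (degree n G v < n)%N.
Proof.
move=> GE; rewrite degreeE //; have n0 : (0 < n)%N by case: n v {G GE} => [[]|].
rewrite -[X in (_ < X)%N](prednK n0) ltnS -(card_star v).
by rewrite subset_leq_card // subsetIr.
Qed.

Definition ndeg (n m : nat) (v : 'I_n) (a : nat) : nat :=
  #|[set G : graph n | is_graph n m G && (degree n G v == a)]|.

Definition npair (n m : nat) (u v : 'I_n) (a b : nat) : nat :=
  #|[set G : graph n | [&& is_graph n m G, degree n G u == a & degree n G v == b]]|.

Lemma card_graphs n m : #|[set G : graph n | is_graph n m G]| = 'C(NN n, m).
Proof. by rewrite -card_edges -cards_draws. Qed.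

Lemma ndegE n m (v : 'I_n) a : (a <= m)%N ->
  ndeg m v a = ('C(n.-1, a) * 'C(NN n - n.-1, m - a))%N.
Proof.
move=> am.
have dd : [disjoint star n v & edges n :\: star n v].
  by rewrite -setI_eq0 setIDA setIC setDIl setDv setI0.
have eE : star n v :|: (edges n :\: star n v) = edges n.
  by rewrite -{1}(setIidPr (star_sub v)) setID.
pose P := fun X : graph n => #|X| == a.
pose Q := fun X : graph n => #|X| == (m - a)%N.
have -> : 'C(n.-1, a) = #|[set X : graph n | (X \subset star n v) && P X]|.
  by rewrite cards_draws card_star.
have -> : 'C(NN n - n.-1, m - a)
   = #|[set Y : graph n | (Y \subset edges n :\: star n v) && Q Y]|.
  by rewrite cards_draws cardsDS ?star_sub // card_edges card_star.
rewrite -card_subset_split // eE.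
congr (#|pred_of_set _|); apply/setP => G; rewrite !inE /is_graph /P /Q.
case GE : (G \subset edges n) => //=.
rewrite degreeE //; have := cardsID (star n v) G.
have -> : G :\: star n v = G :&: (edges n :\: star n v).
  by rewrite setIDA (setIidPl GE).
move: #|G :&: star n v| #|G :&: (edges n :\: star n v)| #|G| => x y z.
by move=> <-; apply/idP/idP => /andP[/eqP h1 /eqP h2]; apply/andP; split; apply/eqP; lia.
Qed.

Lemma stars_meet n (u v : 'I_n) : u != v -> star n u :&: star n v = [set [set u; v]].
Proof.
move=> uv; apply/setP => e; rewrite inE !in_star inE.
apply/idP/eqP.
  move=> /andP[/andP[/eqP c ue] /andP[_ ve]]; apply/esym/eqP.
  by rewrite eqEcard subUset !sub1set ue ve cards2 uv c.
by move=> ->; rewrite !inE !eqxx cards2 uv orbT.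
Qed.

Lemma card_sizes1 (T : finType) (A : {set T}) a :
  #|[set G : {set T} | (G \subset A) && (#|G :&: A| == a)]| = 'C(#|A|, a).
Proof.
rewrite -cards_draws; congr (#|pred_of_set _|); apply/setP => G; rewrite !inE.
by case GA : (G \subset A) => //=; rewrite (setIidPl GA).
Qed.

Lemma card_sizes4 (T : finType) (A B C D : {set T}) a b c d :
  [disjoint A & B :|: (C :|: D)] -> [disjoint B & C :|: D] -> [disjoint C & D] ->
  #|[set G : {set T} | (G \subset A :|: (B :|: (C :|: D)))
      && [&& #|G :&: A| == a, #|G :&: B| == b, #|G :&: C| == c & #|G :&: D| == d]]|
  = ('C(#|A|, a) * ('C(#|B|, b) * ('C(#|C|, c) * 'C(#|D|, d))))%N.
Proof.
move=> dA dB dC.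
have step (E F : {set T}) e (Q : pred {set T}) : [disjoint E & F] ->
    (forall G, Q G = Q (G :&: F)) ->
    #|[set G : {set T} | (G \subset E :|: F) && ((#|G :&: E| == e) && Q G)]|
    = ('C(#|E|, e) * #|[set G : {set T} | (G \subset F) && Q G]|)%N.
  move=> dEF QF; rewrite -cards_draws -card_subset_split //.
  by congr (#|pred_of_set _|); apply/setP => G; rewrite !inE -QF.
have sub (E F : {set T}) G : E \subset F -> G :&: E = G :&: F :&: E.
  by move=> EF; rewrite -setIA (setIidPr EF).
rewrite (step A) //; last first.
  move=> G; rewrite (sub B (B :|: (C :|: D)) G) ?subsetUl //.
  rewrite (sub C (B :|: (C :|: D)) G) ?(subset_trans (subsetUl C D)) ?subsetUr //.
  by rewrite (sub D (B :|: (C :|: D)) G) ?(subset_trans (subsetUr C D)) ?subsetUr.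
rewrite (step B) //; last first.
  by move=> G; rewrite (sub C (C :|: D) G) ?subsetUl // (sub D (C :|: D) G) ?subsetUr.
rewrite (step C) //; last first.
  by move=> G; rewrite -setIA setIid.
by rewrite card_sizes1.
Qed.

(** The edge [uv] is the only one common to the two stars, so the edges split into four blocks:
    [uv], the rest of each star, and all others. The two summands are the graphs without and with
    [uv]. The [if] guards against [0.-1 = 0], which would count graphs with [uv] at degree [0]. *)
Lemma npairE n m (u v : 'I_n) a b : u != v -> (a + b <= m)%N ->
  npair m u v a b =
  ('C(n - 2, a) * 'C(n - 2, b) * 'C(NN n - (n.-1 + (n - 2)), m - (a + b))
   + (if (0 < a)%N && (0 < b)%N then
        'C(n - 2, a.-1) * 'C(n - 2, b.-1)
        * 'C(NN n - (n.-1 + (n - 2)), (m - (a + b)).+1)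
      else 0))%N.
Proof.
move=> uv abm.
pose A := [set [set u; v]]; pose B := star n u :\: A; pose C := star n v :\: A.
pose D := edges n :\: (star n u :|: star n v).
have AI : star n u :&: star n v = A by exact: stars_meet.
have Au : A \subset star n u by rewrite -AI subsetIl.
have Av : A \subset star n v by rewrite -AI subsetIr.
have inA e : (e \in A) = (e \in star n u) && (e \in star n v) by rewrite -AI in_setI.
have Es w e : e \in star n w -> e \in edges n by move/(subsetP (star_sub w)).
have dA : [disjoint A & B :|: (C :|: D)].
  rewrite -setI_eq0; apply/eqP/setP => e; rewrite !(in_setI, in_setU, in_setD, inA, in_set0).
  by case: (e \in star n u); case: (e \in star n v); rewrite ?andbF.
have dB : [disjoint B & C :|: D].
  rewrite -setI_eq0; apply/eqP/setP => e; rewrite !(in_setI, in_setU, in_setD, inA, in_set0).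
  by case: (e \in star n u); case: (e \in star n v); rewrite ?andbF.
have dC : [disjoint C & D].
  rewrite -setI_eq0; apply/eqP/setP => e; rewrite !(in_setI, in_setU, in_setD, inA, in_set0).
  by case: (e \in star n u); case: (e \in star n v); rewrite ?andbF.
have UE : A :|: (B :|: (C :|: D)) = edges n.
  apply/setP => e; rewrite !(in_setI, in_setU, in_setD, inA, in_set0).
  case eu : (e \in star n u); case ev : (e \in star n v); rewrite ?andbF ?orbT //=;
    by rewrite ?(Es _ _ eu) ?(Es _ _ ev).
have cA : #|A| = 1%N by rewrite cards1.
have cB : #|B| = (n - 2)%N by rewrite cardsDS // card_star cA; lia.
have cC : #|C| = (n - 2)%N by rewrite cardsDS // card_star cA; lia.
have cD : #|D| = (NN n - (n.-1 + (n - 2)))%N.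
  rewrite cardsDS ?subUset ?star_sub // card_edges cardsU AI cA !card_star.
  have : (0 < n.-1)%N.
    rewrite -(card_star u) card_gt0; apply/set0Pn; exists [set u; v].
    by apply: (subsetP Au); rewrite inE.
  lia.
pose S a b c d := [set G : graph n | (G \subset A :|: (B :|: (C :|: D)))
      && [&& #|G :&: A| == a, #|G :&: B| == b, #|G :&: C| == c & #|G :&: D| == d]].
have cS a' b' c' d' : #|S a' b' c' d'| = ('C(1, a') * ('C(n - 2, b') * ('C(n - 2, c') *
   'C(NN n - (n.-1 + (n - 2)), d'))))%N.
  by rewrite card_sizes4 // cA cB cC cD.
have sz (G : graph n) : G \subset edges n ->
   [/\ degree n G u = #|G :&: A| + #|G :&: B|, degree n G v = #|G :&: A| + #|G :&: C|
     & #|G| = #|G :&: A| + #|G :&: B| + #|G :&: C| + #|G :&: D|]%N.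
  move=> GE.
  have du : degree n G u = (#|G :&: A| + #|G :&: B|)%N.
    rewrite degreeE // -(cardsID A (G :&: star n u)) -setIA (setIidPr Au).
    by rewrite /B setIDA.
  have dv : degree n G v = (#|G :&: A| + #|G :&: C|)%N.
    rewrite degreeE // -(cardsID A (G :&: star n v)) -setIA (setIidPr Av).
    by rewrite /C setIDA.
  split=> //.
  have := cardsID (star n u :|: star n v) G.
  have -> : G :\: (star n u :|: star n v) = G :&: D by rewrite setIDA (setIidPl GE).
  rewrite setIUr cardsU setIACA setIid AI -!degreeE // du dv; lia.
have nE : npair m u v a b = #|S 0 a b (m - (a + b))%N :|:
    (if (0 < a)%N && (0 < b)%N then S 1 a.-1 b.-1 (m - (a + b)).+1 else set0)|.
  congr (#|pred_of_set _|); apply/setP => G; rewrite [LHS]inE [RHS]in_setU.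
  rewrite /is_graph {1}/S inE UE.
  have -> : (G \in (if (0 < a)%N && (0 < b)%N then S 1 a.-1 b.-1 (m - (a + b)).+1 else set0))
     = (0 < a)%N && (0 < b)%N && (G \in S 1 a.-1 b.-1 (m - (a + b)).+1).
    by case: (_ && _); rewrite ?in_set0.
  rewrite inE UE.
  case GE : (G \subset edges n); last by rewrite /= andbF.
  have [-> -> ->] := sz _ GE.
  have : (#|G :&: A| <= 1)%N by rewrite -cA subset_leq_card // subsetIr.
  move: #|G :&: A| #|G :&: B| #|G :&: C| #|G :&: D| => x y z t x1 /=.
  lia.
rewrite nE cardsU.
have -> : S 0 a b (m - (a + b))%N :&: (if (0 < a)%N && (0 < b)%N then
   S 1 a.-1 b.-1 (m - (a + b)).+1 else set0) = set0.
  apply/setP => G; rewrite in_setI in_set0; case: ifP => _; rewrite ?in_set0 ?andbF //.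
  by rewrite /S !in_set; case: (#|G :&: A|) => [|?]; rewrite /= !andbF.
rewrite cards0 subn0 cS bin0; case: ifP => _; last by rewrite cards0; lia.
by rewrite cS bin1; lia.
Qed.

(** * The likelihood ratio as a vertex average, and the truncated second moment *)

Section Reduction.
Variables (R : realType) (n m k : nat).
Hypothesis mN : (m <= NN n)%N.

(** Hypergeometric: the law of the degree of a fixed vertex under the null distribution. *)
Definition pdeg (a : nat) : R :=
  ('C(n.-1, a) * 'C(NN n - n.-1, m - a))%:R / ('C(NN n, m))%:R.

(** Given the hub, the likelihood ratio depends on the graph only through the hub degree [a]:
    ['C(a, k)] counts the sets [S] that fit inside the [a] edges present at the hub. *)
Definition lam (a : nat) : R :=
  ('C(a, k) * 'C(NN n, m))%:R / ('C(n.-1, k) * 'C(NN n - k, m - k))%:R.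

Definition E0 (f : graph n -> R) : R :=
  \sum_(G : graph n | is_graph n m G) f G / ('C(NN n, m))%:R.

Lemma binN_gt0 : (0 : R) < ('C(NN n, m))%:R.
Proof. by rewrite ltr0n bin_gt0. Qed.

Lemma P1E (G : graph n) : is_graph n m G ->
  P1 R n m k G = P0 R n m G * (n%:R^-1 * \sum_v lam (degree n G v)).
Proof.
move=> gG; have GE : G \subset edges n by case/andP: gG.
rewrite /P1 /P0 gG mulrA [RHS]mulr_sumr.
apply: eq_bigr => v _.
transitivity (\sum_(S : graph n | (S \subset star n v :&: G) && (#|S| == k))
   (n%:R^-1 * ('C(n.-1, k))%:R^-1 * ('C(NN n - k, m - k))%:R^-1) : R).
  rewrite big_mkcond [RHS]big_mkcond; apply: eq_bigr => S _ /=.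
  rewrite subsetI -andbA; case: (S \subset star n v) => //=.
  by case: (#|S| == k); case: (S \subset G); rewrite ?mulr0.
rewrite (eq_bigl (fun T => T \in [set S : graph n | (S \subset star n v :&: G) && (#|S| == k)])); last first.
  by move=> S; rewrite inE.
rewrite sumr_const cards_draws setIC -degreeE // /lam !natrM invfM -[_ *+ 'C(_, _)]mulr_natl.
have h := lt0r_neq0 binN_gt0.
move: (n%:R^-1) ('C(n.-1, k)%:R^-1) ('C(NN n - k, m - k)%:R^-1) => x y z.
by field.
Qed.

Lemma LambdaE (G : graph n) : is_graph n m G ->
  Lambda R n m k G = n%:R^-1 * \sum_v lam (degree n G v).
Proof.
move=> gG; rewrite /Lambda P1E // mulrAC divff ?mul1r //.
by rewrite /P0 gG invr_eq0 lt0r_neq0 // binN_gt0.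
Qed.

Lemma lam_ge0 a : 0 <= lam a.
Proof. by rewrite divr_ge0 ?ler0n. Qed.

Lemma lam_le a b : (a <= b)%N -> lam a <= lam b.
Proof.
move=> ab; rewrite ler_wpM2r ?invr_ge0 ?ler0n // ler_nat leq_mul2r.
by rewrite leq_bin2l ?orbT.
Qed.

Lemma pdeg_ge0 a : 0 <= pdeg a.
Proof. by rewrite divr_ge0 ?ler0n. Qed.

Lemma E0_le f g : (forall G, is_graph n m G -> f G <= g G) -> E0 f <= E0 g.
Proof.
move=> fg; apply: ler_sum => G gG.
by rewrite ler_pM2r ?invr_gt0 ?binN_gt0 ?fg.
Qed.

Lemma E0D f g : E0 (fun G => f G + g G) = E0 f + E0 g.
Proof. by rewrite /E0 -big_split; apply: eq_bigr => G _; rewrite mulrDl. Qed.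

Lemma E0Z c f : E0 (fun G => c * f G) = c * E0 f.
Proof. by rewrite /E0 mulr_sumr; apply: eq_bigr => G _; rewrite mulrA. Qed.

Lemma E0_sum (I : finType) (P : pred I) (f : I -> graph n -> R) :
  E0 (fun G => \sum_(i | P i) f i G) = \sum_(i | P i) E0 (f i).
Proof. by rewrite /E0 exchange_big; apply: eq_bigr => G _; rewrite mulr_suml. Qed.

Lemma E0_1 : E0 (fun=> 1) = 1.
Proof.
rewrite /E0 (eq_bigl (fun T => T \in [set G : graph n | is_graph n m G])); last first.
  by move=> G; rewrite inE.
by rewrite sumr_const card_graphs mul1r -[_ *+ _]mulr_natl divff // lt0r_neq0 // binN_gt0.
Qed.

Lemma E0_ind (P : pred (graph n)) :
  E0 (fun G => (P G)%:R) = #|[set G : graph n | is_graph n m G && P G]|%:R / ('C(NN n, m))%:R.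
Proof.
rewrite /E0 -mulr_suml; congr (_ / _).
rewrite -sum1_card natr_sum big_mkcond [RHS]big_mkcond; apply: eq_bigr => G _.
by rewrite inE; case: is_graph => //; case: (P G).
Qed.

Lemma E0_degree (f : nat -> R) (v : 'I_n) : (n <= m)%N ->
  E0 (fun G => f (degree n G v)) = \sum_(a < n) f a * pdeg a.
Proof.
move=> nm.
transitivity (E0 (fun G => \sum_(a < n) f a * (degree n G v == a)%:R)).
  apply: eq_bigr => G /andP[GE _]; congr (_ / _).
  rewrite (bigD1 (Ordinal (degree_lt v GE))) //= eqxx mulr1 big1 ?addr0 // => i.
  rewrite -val_eqE /= eq_sym => /negbTE ->; by rewrite mulr0.
rewrite E0_sum; apply: eq_bigr => a _.
rewrite E0Z E0_ind; congr (_ * (_%:R / _)).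
by apply: ndegE; apply: leq_trans nm; apply: ltnW.
Qed.

Lemma E0_degree2 (f g : nat -> R) (u v : 'I_n) :
  E0 (fun G => f (degree n G u) * g (degree n G v)) =
  \sum_(a < n) \sum_(b < n) f a * g b * ((npair m u v a b)%:R / ('C(NN n, m))%:R).
Proof.
transitivity (E0 (fun G => \sum_(a < n) \sum_(b < n)
    f a * g b * ((degree n G u == a) && (degree n G v == b))%:R)).
  apply: eq_bigr => G /andP[GE _]; congr (_ / _).
  rewrite (bigD1 (Ordinal (degree_lt u GE))) //= [X in _ + X]big1 ?addr0; last first.
    move=> i; rewrite -val_eqE /= eq_sym => /negbTE ->.
    by rewrite big1 // => j _; rewrite mulr0.
  rewrite (bigD1 (Ordinal (degree_lt v GE))) //= !eqxx mulr1 big1 ?addr0 // => i.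
  by rewrite -val_eqE /= eq_sym => /negbTE ->; rewrite mulr0.
rewrite E0_sum; apply: eq_bigr => a _.
rewrite E0_sum; apply: eq_bigr => b _.
by rewrite E0Z E0_ind.
Qed.

Definition csum (J : nat) : R := \sum_(a < n | (a < J)%N) lam a * pdeg a.

Definition flam (J a : nat) : R := if (a < J)%N then lam a else 0.

Lemma csumE J : csum J = \sum_(a < n) flam J a * pdeg a.
Proof.
rewrite /csum big_mkcond; apply: eq_bigr => a _; rewrite /flam.
by case: ifP; rewrite ?mul0r.
Qed.

Lemma flam_ge0 J a : 0 <= flam J a.
Proof. by rewrite /flam; case: ifP => // _; rewrite lam_ge0. Qed.

Definition Ltr (J : nat) (G : graph n) : R := n%:R^-1 * \sum_v flam J (degree n G v).

Lemma E0_Ltr J : (0 < n)%N -> (n <= m)%N -> E0 (Ltr J) = csum J.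
Proof.
move=> n0 nm; rewrite /Ltr E0Z E0_sum (eq_bigr (fun=> csum J)); last first.
  by move=> v _; rewrite csumE (E0_degree (flam J)).
by rewrite sumr_const card_ord -[csum J *+ n]mulr_natl mulrA mulVf ?mul1r // pnatr_eq0 -lt0n.
Qed.

(** Expand the square over pairs of vertices. On the diagonal, monotonicity of [lam] replaces one of
    the two factors by [lam J]; off it, the pair hypothesis factors the expectation up to [1 + eps].
    Each row is charged [n] off-diagonal terms instead of [n - 1]. *)
Lemma E0_Ltr2 J eps : (0 < n)%N -> (n <= m)%N -> 0 <= eps ->
  (forall (u v : 'I_n) a b, u != v -> (a < J)%N -> (b < J)%N -> (a < n)%N -> (b < n)%N ->
     (npair m u v a b)%:R / ('C(NN n, m))%:R <= (1 + eps) * (pdeg a * pdeg b)) ->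
  E0 (fun G => Ltr J G ^+ 2) <= lam J / n%:R * csum J + (1 + eps) * csum J ^+ 2.
Proof.
move=> n0 nm eps0 H.
have nR : (0 : R) < n%:R by rewrite ltr0n.
have -> : E0 (fun G => Ltr J G ^+ 2) = n%:R^-1 ^+ 2 *
    \sum_u \sum_v E0 (fun G => flam J (degree n G u) * flam J (degree n G v)).
  transitivity (E0 (fun G => n%:R^-1 ^+ 2 *
     \sum_u \sum_v flam J (degree n G u) * flam J (degree n G v))).
    apply: eq_bigr => G _; congr (_ / _); rewrite /Ltr exprMn; congr (_ * _).
    by rewrite expr2 mulr_suml; apply: eq_bigr => u _; rewrite mulr_sumr.
  rewrite E0Z; congr (_ * _); rewrite E0_sum; apply: eq_bigr => u _.
  by rewrite E0_sum.
have diag u : E0 (fun G => flam J (degree n G u) * flam J (degree n G u)) <= lam J * csum J.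
  rewrite (E0_degree (fun a => flam J a * flam J a)) // csumE mulr_sumr; apply: ler_sum => a _.
  rewrite [X in _ <= X]mulrA; apply: ler_wpM2r; first exact: pdeg_ge0.
  rewrite /flam; case: ifP => [aJ|]; last by rewrite !mulr0.
  by apply: ler_wpM2r; [exact: lam_ge0 | apply: lam_le; apply: ltnW].
have off u v : u != v ->
    E0 (fun G => flam J (degree n G u) * flam J (degree n G v)) <= (1 + eps) * csum J ^+ 2.
  move=> uv; rewrite (E0_degree2 (flam J) (flam J)) csumE expr2 mulr_suml mulr_sumr.
  apply: ler_sum => a _; rewrite !mulr_sumr; apply: ler_sum => b _.
  have [aJ|aJ] := ltnP a J; last by rewrite {1 3}/flam ltnNge aJ /= !(mul0r, mulr0).
  have [bJ|bJ] := ltnP b J; last by rewrite {2 4}/flam ltnNge bJ /= !(mul0r, mulr0).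
  apply: (@le_trans _ _ (flam J a * flam J b * ((1 + eps) * (pdeg a * pdeg b)))).
    by rewrite ler_wpM2l ?mulr_ge0 ?flam_ge0 // H.
  by rewrite le_eqVlt; apply/orP; left; apply/eqP; ring.
apply: (@le_trans _ _ (n%:R^-1 ^+ 2 * \sum_(u < n) (lam J * csum J + n%:R * ((1 + eps) * csum J ^+ 2)))).
  rewrite ler_wpM2l ?exprn_ge0 ?invr_ge0 ?ler0n //; apply: ler_sum => u _.
  rewrite (bigD1 u) //=; apply: lerD; first exact: diag.
  have -> : n%:R * ((1 + eps) * csum J ^+ 2) = \sum_(v < n) ((1 + eps) * csum J ^+ 2).
    by rewrite sumr_const card_ord mulr_natl.
  rewrite big_mkcond; apply: ler_sum => v _; case: ifP => [vu|_].
    by apply: off; rewrite eq_sym.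
  by rewrite mulr_ge0 ?sqr_ge0 // addr_ge0.
rewrite sumr_const card_ord -[(_ + _) *+ n]mulr_natl.
rewrite le_eqVlt; apply/orP; left; apply/eqP; field.
by rewrite lt0r_neq0.
Qed.

Definition ptail (J : nat) : R := \sum_(a < n | (J <= a)%N) pdeg a.

(** The planted law is [Lambda] times the null law, so it suffices to dominate both [1] and [Lambda]
    on the symmetric difference by one function. That function is [bad + D], the exceedance
    indicator plus the Chebyshev quotient of [Ltr] around its mean; [bd] bounds its null
    expectation, by a union bound over vertices for [bad] and the second moment for [D]. *)
Lemma symdiff_bound (alpha eps : R) J : (0 < n)%N -> (n <= m)%N -> 0 <= eps ->
  (forall j : nat, (tstar R alpha n m <= j%:R) = (J <= j)%N) ->
  (forall (u v : 'I_n) a b, u != v -> (a < J)%N -> (b < J)%N -> (a < n)%N -> (b < n)%N ->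
     (npair m u v a b)%:R / ('C(NN n, m))%:R <= (1 + eps) * (pdeg a * pdeg b)) ->
  csum J < 1 ->
  let bd := n%:R * ptail J + (lam J / n%:R + eps) / (1 - csum J) ^+ 2 in
  Prob R n (P0 R n m) (symdiffAB R alpha n m k) <= bd /\
  Prob R n (P1 R n m k) (symdiffAB R alpha n m k) <= bd.
Proof.
move=> n0 nm eps0 HJ Hpair c1 bd.
set c := csum J in c1 bd *.
have c0 : 0 <= c by rewrite /c csumE sumr_ge0 // => a _; rewrite mulr_ge0 ?flam_ge0 ?pdeg_ge0.
pose bad G : R := (J <= maxdeg n G)%:R.
pose D G : R := (Ltr J G - c) ^+ 2 / (1 - c) ^+ 2.
have d0 : 0 < (1 - c) ^+ 2 by rewrite exprn_gt0 // subr_gt0.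
have D0 G : 0 <= D G by rewrite divr_ge0 ?sqr_ge0 // ltW.
have Ebad : E0 bad <= n%:R * ptail J.
  apply: (@le_trans _ _ (E0 (fun G => \sum_v (J <= degree n G v)%:R))).
    apply: E0_le => G _; rewrite /bad; case: leqP => //= h; last by rewrite sumr_ge0.
    have /existsP [v hv] : [exists v, (J <= degree n G v)%N].
      rewrite -[X in is_true X]negbK negb_exists; apply/negP => /forallP hf.
      have : (maxdeg n G < J)%N; last by rewrite ltnNge h.
      have J0 : (0 < J)%N by have := hf (Ordinal n0); rewrite -ltnNge; apply: leq_ltn_trans.
      by rewrite -(prednK J0) ltnS; apply/bigmax_leqP => v _; have := hf v; lia.
    by rewrite (bigD1 v) //= hv lerDl sumr_ge0.
  rewrite E0_sum (eq_bigr (fun=> ptail J)).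
    by rewrite sumr_const card_ord mulr_natl.
  move=> v _; rewrite (E0_degree (fun a => (J <= a)%N%:R)) // /ptail [RHS]big_mkcond.
  by apply: eq_bigr => a _; case: leqP; rewrite ?mul1r ?mul0r.
have ED : E0 D <= (lam J / n%:R + eps) / (1 - c) ^+ 2.
  have -> : E0 D = ((1 - c) ^+ 2)^-1 * (E0 (fun G => Ltr J G ^+ 2) + ((- 2 * c) * E0 (Ltr J) + c ^+ 2 * E0 (fun=> 1))).
    rewrite -!E0Z -!E0D -E0Z; apply: eq_bigr => G _; congr (_ / _).
    rewrite /D [LHS]mulrC; congr (_ * _); ring.
  rewrite E0_1 E0_Ltr // -/c mulrC ler_pM2r ?invr_gt0 //.
  have := E0_Ltr2 n0 nm eps0 Hpair; rewrite -/c => h.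
  have l0 : 0 <= lam J / n%:R by rewrite divr_ge0 ?lam_ge0 ?ler0n.
  have h1 : lam J / n%:R * c <= lam J / n%:R by rewrite ler_piMr // ltW.
  have h2 : eps * c ^+ 2 <= eps by rewrite ler_piMr // exprn_ile1 // ltW.
  move: h h1 h2; set x := lam J / n%:R => h h1 h2; lra.
have key (Q : graph n -> R) :
    (forall G, ~~ is_graph n m G -> Q G = 0) ->
    (forall G, is_graph n m G -> symdiffAB R alpha n m k G ->
        Q G <= (bad G + D G) / ('C(NN n, m))%:R) ->
    Prob R n Q (symdiffAB R alpha n m k) <= bd.
  move=> Q0 QD; apply: (@le_trans _ _ (E0 (fun G => bad G + D G))); last first.
    by rewrite E0D /bd; apply: lerD.
  rewrite /Prob /E0 big_mkcond [X in _ <= X]big_mkcond; apply: ler_sum => G _.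
  have [gG|gG] := boolP (is_graph n m G); last by rewrite Q0 //; case: ifP.
  case: ifP => hE; first exact: QD.
  by rewrite divr_ge0 ?ler0n // addr_ge0.
have pt G : is_graph n m G -> symdiffAB R alpha n m k G ->
   1 <= bad G + D G /\ Lambda R n m k G <= bad G + D G.
  move=> gG; rewrite /symdiffAB HJ.
  have [hB|hB] := leqP J (maxdeg n G).
    rewrite eqb_id -ltNge => hL; have -> : bad G = 1 by rewrite /bad hB.
    by have := D0 G; split; lra.
  rewrite eqbF_neg negbK => hL.
  have e : Lambda R n m k G = Ltr J G.
    rewrite LambdaE // /Ltr; congr (_ * _); apply: eq_bigr => v _; rewrite /flam.
    by rewrite (leq_ltn_trans _ hB) // /maxdeg (leq_bigmax v).
  have -> : bad G = 0 by rewrite /bad leqNgt hB.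
  rewrite add0r e; rewrite e in hL.
  (* On this event [x = Ltr] satisfies both [1 <= (x-c)^2/(1-c)^2] and [x <= (x-c)^2/(1-c)^2]:
     the second bound is what transfers the estimate to the planted law. *)
  rewrite /D !ler_pdivlMr // mul1r; split; rewrite -subr_ge0.
    have -> : (Ltr J G - c) ^+ 2 - (1 - c) ^+ 2 = (Ltr J G - 1) * (Ltr J G + 1 - 2 * c) by ring.
    by apply: mulr_ge0; lra.
  have -> : (Ltr J G - c) ^+ 2 - Ltr J G * (1 - c) ^+ 2 = (Ltr J G - 1) * (Ltr J G - c ^+ 2) by ring.
  have : c ^+ 2 <= 1 by rewrite exprn_ile1 // ltW.
  by move=> c2; apply: mulr_ge0; lra.
split; apply: key.
- by move=> G /negbTE h; rewrite /P0 h.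
- move=> G gG hE; rewrite /P0 gG -[X in X <= _]mul1r ler_pM2r ?invr_gt0 ?binN_gt0 //.
  by case: (pt G gG hE).
- move=> G /negbTE h; rewrite /P1 big1 // => v _; rewrite big1 // => S _.
  by rewrite h andbF mulr0.
- move=> G gG hE; rewrite P1E // -LambdaE // mulrC /P0 gG ler_pM2r ?invr_gt0 ?binN_gt0 //.
  by case: (pt G gG hE).
Qed.
End Reduction.

(** * Near-independence of the degrees of two vertices *)

Section Pairs.
Variable R : realType.

(** Removing one element from a set of size [A] multiplies ['C(A, m)] by [1 - m/A], which increases
    with [A]: the smaller set loses more at each of the [i] removals. *)
Lemma bin_shift_le (A B m i : nat) : (A <= B)%N -> (m + i <= A)%N ->
  ('C(A - i, m) * 'C(B, m) <= 'C(A, m) * 'C(B - i, m))%N.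
Proof.
move=> AB; elim: i => [|i IH] mA; first by rewrite !subn0.
have {}IH := IH ltac:(lia).
have eA := mul_bin_down (A - i) m; have eB := mul_bin_down (B - i) m.
have -> : (A - i.+1 = (A - i).-1)%N by lia.
have -> : (B - i.+1 = (B - i).-1)%N by lia.
have pB : (0 < 'C(B - i, m))%N by rewrite bin_gt0; lia.
have pA : (0 < A - i)%N by lia.
rewrite -(leq_pmul2l pA) -(leq_pmul2l (leq_trans pA (leq_sub2r i AB))).
rewrite -(leq_pmul2l pB).
have f : ((A - i - m) * (B - i) <= (B - i - m) * (A - i))%N by nia.
move: eA eB IH f.
move: 'C(A - i, m) 'C(B - i, m) 'C((A - i).-1, m) 'C((B - i).-1, m) 'C(A, m) 'C(B, m).
move: (A - i - m)%N (B - i - m)%N => u v x y x' y' z w eA eB IH f.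
have -> : (y * ((B - i) * ((A - i) * (x' * w))) = (y * w * (B - i)) * ((A - i) * x'))%N by ring.
have -> : (y * ((B - i) * ((A - i) * (z * y'))) = (y * z * (A - i)) * ((B - i) * y'))%N by ring.
rewrite eA eB.
have -> : (y * w * (B - i) * (u * x) = (x * w) * (y * (u * (B - i))))%N by ring.
have -> : (y * z * (A - i) * (v * y) = (z * y) * (y * (v * (A - i))))%N by ring.
by apply: leq_mul => //; rewrite leq_mul2l f orbT.
Qed.

(** Without [1 + x], the quotient of the two sides is [(m-a-b)/(m-a)] times
    [(N'-m+a+1)/(M-m+a+b+1)]. The first factor is at most [1]; the second exceeds [1] by at most
    [(N'-M)/(M-m)], hence by at most [x]. *)
Lemma bin_pair_step (x : R) (M N' m a b : nat) :
  (a + b < m)%N -> (m <= M)%N -> (M <= N')%N -> 0 <= x -> (N' - M)%:R <= x * (M - m)%:R ->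
  ('C(M, m - (a.+1 + b)))%:R * ('C(N', m - a))%:R
    <= (1 + x) * (('C(M, m - (a + b)))%:R * ('C(N', m - a.+1))%:R) :> R.
Proof.
move=> abm mM MN x0 hx.
have e1 := mul_bin_left M (m - (a.+1 + b)).
have e2 := mul_bin_left N' (m - a.+1).
have E1 : ((m - (a.+1 + b)).+1 = m - (a + b))%N by lia.
have E2 : ((m - a.+1).+1 = m - a)%N by lia.
rewrite E1 in e1; rewrite E2 in e2.
have p1 : (0 : R) < (M - (m - (a.+1 + b)))%:R by rewrite ltr0n; lia.
have p2 : (0 : R) < (m - a)%:R by rewrite ltr0n; lia.
move/(congr1 (fun t : nat => t%:R : R)): e1; rewrite !natrM => e1.
move/(congr1 (fun t : nat => t%:R : R)): e2; rewrite !natrM => e2.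
have h : (m - (a + b))%:R * (N' - (m - a.+1))%:R
   <= (1 + x) * (m - a)%:R * (M - (m - (a.+1 + b)))%:R :> R.
  have h1 : (m - (a + b))%:R <= (m - a)%:R :> R by rewrite ler_nat; lia.
  have h2 : (N' - (m - a.+1))%:R <= (1 + x) * (M - (m - (a.+1 + b)))%:R :> R.
    have h3 : (M - m)%:R <= (M - (m - (a.+1 + b)))%:R :> R by rewrite ler_nat; lia.
    have h4 : (N' - (m - a.+1))%:R <= (N' - M)%:R + (M - (m - (a.+1 + b)))%:R :> R.
      by rewrite -natrD ler_nat; lia.
    have h5 : x * (M - m)%:R <= x * (M - (m - (a.+1 + b)))%:R by exact: ler_wpM2l.
    by rewrite mulrDl mul1r; lra.
  have -> : (1 + x) * (m - a)%:R * (M - (m - (a.+1 + b)))%:R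
     = (m - a)%:R * ((1 + x) * (M - (m - (a.+1 + b)))%:R) by ring.
  by apply: ler_pM; rewrite ?ler0n.
rewrite -(ler_pM2l p1) -(ler_pM2l p2).
move: e1 e2 h.
move: (M - (m - (a.+1 + b)))%:R (m - a)%:R (m - (a + b))%:R (N' - (m - a.+1))%:R => P Q S T.
have c1 := ler0n R 'C(M, m - (a + b)); have c2 := ler0n R 'C(N', m - a.+1).
move: 'C(M, m - (a.+1 + b))%:R 'C(N', m - a)%:R 'C(M, m - (a + b))%:R 'C(N', m - a.+1)%:R c1 c2.
move=> c1 c2 c3 c4 p3 p4 e1 e2 h.
have -> : Q * (P * (c1 * c2)) = (P * c1) * (Q * c2) by ring.
rewrite -e1 e2.
have -> : S * c3 * (T * c4) = (c3 * c4) * (S * T) by ring.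
have -> : Q * (P * ((1 + x) * (c3 * c4))) = (c3 * c4) * ((1 + x) * Q * P) by ring.
by apply: ler_wpM2l => //; apply: mulr_ge0.
Qed.

(* The ratio of the joint degree law to the product of its marginals is at most [K] at [a = b = 0],
   and grows by a factor at most [1 + x] with each unit step in [a] or [b]. *)
Lemma bin_pair_le (x K : R) (M N' N m a b : nat) :
  (a + b <= m)%N -> (m <= M)%N -> (M <= N')%N -> 0 <= x -> (N' - M)%:R <= x * (M - m)%:R ->
  ('C(M, m))%:R * ('C(N, m))%:R <= K * ('C(N', m))%:R ^+ 2 ->
  ('C(M, m - (a + b)))%:R * ('C(N, m))%:R
    <= (1 + x) ^+ (a + b) * K * (('C(N', m - a))%:R * ('C(N', m - b))%:R) :> R.
Proof.
move=> abm mM MN x0 hx h0.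
have binR (p q : nat) : (q <= p)%N -> (0 : R) < ('C(p, q))%:R by rewrite ltr0n bin_gt0.
elim: a abm => [|a IHa] abm.
  rewrite add0n subn0; elim: b abm => [|b IHb] abm.
    by rewrite expr0 mul1r !subn0 -expr2.
  have {}IHb := IHb ltac:(lia).
  have := @bin_pair_step x M N' m b 0 ltac:(lia) mM MN x0 hx; rewrite !addn0 => st.
  have p1 : (0 : R) < ('C(N', m - b))%:R by apply: binR; lia.
  rewrite -(ler_pM2l p1) exprS.
  move: st IHb (ler0n R 'C(N', m - b.+1)) (ler0n R 'C(N, m)).
  move: 'C(M, m - b.+1)%:R 'C(N', m - b)%:R 'C(M, m - b)%:R 'C(N', m - b.+1)%:R p1.
  move: ((1 + x) ^+ b) 'C(N, m)%:R 'C(N', m)%:R => E c3 c4 c1 c2 c5 c6 p1 st IHb q6 q3.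
  apply: (@le_trans _ _ (c3 * ((1 + x) * (c5 * c6)))).
    have -> : c2 * (c1 * c3) = c3 * (c1 * c2) by ring.
  exact: ler_wpM2l.
  have -> : c3 * ((1 + x) * (c5 * c6)) = ((1 + x) * c6) * (c5 * c3) by ring.
  have -> : c2 * ((1 + x) * E * K * (c4 * c6)) = ((1 + x) * c6) * (E * K * (c4 * c2)) by ring.
  by apply: ler_wpM2l => //; apply: mulr_ge0 => //; lra.
have {}IHa := IHa ltac:(lia).
have st := @bin_pair_step x M N' m a b ltac:(lia) mM MN x0 hx.
have p1 : (0 : R) < ('C(N', m - a))%:R by apply: binR; lia.
rewrite -(ler_pM2l p1) addSn exprS -addSn.
move: st IHa (ler0n R 'C(N', m - a.+1)) (ler0n R 'C(N, m)).
move: 'C(M, m - (a.+1 + b))%:R 'C(N', m - a)%:R 'C(M, m - (a + b))%:R 'C(N', m - a.+1)%:R p1.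
move: ((1 + x) ^+ (a + b)) 'C(N, m)%:R 'C(N', m - b)%:R => E c3 c4 c1 c2 c5 c6 p1 st IHb q6 q3.
apply: (@le_trans _ _ (c3 * ((1 + x) * (c5 * c6)))).
  have -> : c2 * (c1 * c3) = c3 * (c1 * c2) by ring.
  exact: ler_wpM2l.
have -> : c3 * ((1 + x) * (c5 * c6)) = ((1 + x) * c6) * (c5 * c3) by ring.
have -> : c2 * ((1 + x) * E * K * (c6 * c4)) = ((1 + x) * c6) * (E * K * (c2 * c4)) by ring.
by apply: ler_wpM2l => //; apply: mulr_ge0 => //; lra.
Qed.

(** One factor per source of dependence: the possible edge [uv]; the at most [2J] unit steps in the
    two degrees, each costing [1 + 8/n]; and the ratio [K] at [a = b = 0]. *)
Definition pair_factor (n m J : nat) : R :=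
  (1 + 4 * J%:R ^+ 2 / m%:R) * (1 + 8 / n%:R) ^+ (J + J)
  * ((NN n - n.-1).+1%:R / ((NN n - n.-1).+1 - m)%:R).

Lemma npair_le (n m J : nat) (u v : 'I_n) a b : u != v -> (2 < n)%N -> (2 * n <= m)%N ->
  (n * n <= 8 * (NN n - (n.-1 + (n - 2)) - m))%N -> (2 * J <= n)%N ->
  (a < J)%N -> (b < J)%N -> (a < n)%N -> (b < n)%N ->
  (npair m u v a b)%:R / ('C(NN n, m))%:R <= pair_factor n m J * (pdeg R n m a * pdeg R n m b).
Proof.
move=> uv n2 nm hM J2 aJ bJ an bn.
have nn : (0 < n * n)%N by rewrite muln_gt0; lia.
have eN : (n * n.-1 = 2 * NN n)%N by rewrite -(mul_bin_diag n 1) bin1.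
set M := (NN n - (n.-1 + (n - 2)))%N in hM *.
have mM : (m < M)%N by lia.
set N' := (NN n - n.-1)%N.
have NM : (N' - M = n - 2)%N by rewrite /N' /M; nia.
have MN' : (M <= N')%N by rewrite /N' /M; lia.
have n0 : (0 : R) < n%:R by rewrite ltr0n; lia.
have m0 : (0 : R) < m%:R by rewrite ltr0n; lia.
pose K : R := N'.+1%:R / (N'.+1 - m)%:R.
have k0 : (0 : R) < (N'.+1 - m)%:R by rewrite ltr0n; lia.
have K0 : 0 <= K by rewrite divr_ge0 ?ler0n.
have x0 : (0 : R) <= 8 / n%:R by rewrite divr_ge0 ?ler0n.
have bn0 : (0 : R) < 'C(NN n, m)%:R by rewrite ltr0n bin_gt0; clear -mM MN'; lia.
have b1 c : 'C(n - 2, c)%:R <= 'C(n.-1, c)%:R :> R by rewrite ler_nat leq_bin2l //; clear; lia.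
have pw : (1 + 8 / n%:R) ^+ (a + b) <= (1 + 8 / n%:R) ^+ (J + J) :> R.
  by apply: ler_weXn2l; [clear -x0; lra | clear -aJ bJ; lia].
(* The null count has [n - 1] more edges than [N'], whereas [M] has [n - 2] fewer. Shifting both by
   [n - 2] therefore leaves ['C(N'.+1, m)], and the one extra element gives the quotient [K]. *)
have h0 : ('C(M, m))%:R * ('C(NN n, m))%:R <= K * ('C(N', m))%:R ^+ 2 :> R.
  have h : ('C(N' - (n - 2), m) * 'C(NN n, m) <= 'C(N', m) * 'C(NN n - (n - 2), m))%N.
    by apply: bin_shift_le; rewrite /N'; lia.
  have E1 : (N' - (n - 2) = M)%N by rewrite /N' /M; lia.
  have E2 : (NN n - (n - 2) = N'.+1)%N by rewrite /N'; lia.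
  rewrite E1 E2 in h.
  have := mul_bin_down N'.+1 m => /= /(congr1 (fun t : nat => t%:R : R)); rewrite !natrM => e.
  have -> : K * 'C(N', m)%:R ^+ 2 = ('C(N', m) * 'C(N'.+1, m))%:R.
    have e' : 'C(N'.+1, m)%:R = N'.+1%:R * 'C(N', m)%:R / (N'.+1 - m)%:R :> R.
      by rewrite e mulrAC divff ?mul1r // lt0r_neq0.
    rewrite natrM e' /K; field; exact: lt0r_neq0.
  by rewrite -natrM ler_nat.
have hx : (N' - M)%:R <= 8 / n%:R * (M - m)%:R :> R.
  rewrite mulrAC ler_pdivlMr // -!natrM ler_nat NM; nia.
have abm : (a + b <= m)%N by clear -aJ bJ J2 nm; lia.
have main := bin_pair_le abm (ltnW mM) MN' x0 hx h0.
(* Graphs containing [uv] are few compared with those avoiding it: lowering each degree by one costs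
   at most [2J/n], and returning one edge to the remaining block gains at most [n^2/m], in total
   [4J^2/m]. *)
have cn : (npair m u v a b)%:R <= (1 + 4 * J%:R ^+ 2 / m%:R)
    * ('C(n - 2, a) * 'C(n - 2, b) * 'C(M, m - (a + b)))%:R :> R.
  rewrite npairE // -/M natrD mulrDl mul1r lerD2l.
  case: ifP => [/andP[a0 b0]|_]; last by rewrite mulr_ge0 ?ler0n // divr_ge0 ?ler0n // mulr_ge0 ?sqr_ge0.
  have st c : (0 < c)%N -> (c < J)%N -> (n * 'C(n - 2, c.-1) <= 2 * J * 'C(n - 2, c))%N.
    move=> c0 cJ; have := mul_bin_left (n - 2) c.-1; rewrite (prednK c0) => e.
    apply: (@leq_trans (2 * ((n - 2 - c.-1) * 'C(n - 2, c.-1)))).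
      by rewrite mulnA leq_mul2r; apply/orP; right; clear -c0 cJ J2; lia.
    by rewrite -e mulnA leq_mul2r; apply/orP; right; clear -cJ; lia.
  have st2 : (m * 'C(M, (m - (a + b)).+1) <= n * n * 'C(M, m - (a + b)))%N.
    have e := mul_bin_left M (m - (a + b)).
    apply: (@leq_trans (2 * ((m - (a + b)).+1 * 'C(M, (m - (a + b)).+1)))).
      by rewrite mulnA leq_mul2r; apply/orP; right; clear -aJ bJ J2 nm; lia.
    rewrite e mulnA leq_mul2r; apply/orP; right.
    by apply: (@leq_trans (2 * NN n)); [rewrite /M; clear; lia | rewrite -eN leq_mul2l leq_pred orbT].
  have tot : (m * ('C(n - 2, a.-1) * 'C(n - 2, b.-1) * 'C(M, (m - (a + b)).+1))
     <= 4 * J ^ 2 * ('C(n - 2, a) * 'C(n - 2, b) * 'C(M, m - (a + b))))%N.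
    rewrite -(leq_pmul2l nn).
    have := leq_mul (leq_mul (st a a0 aJ) (st b b0 bJ)) st2.
    move: 'C(n - 2, a.-1) 'C(n - 2, b.-1) 'C(M, (m - (a + b)).+1) 'C(n - 2, a) 'C(n - 2, b) 'C(M, m - (a + b)).
    move=> c1 c2 c3 c4 c5 c6 h; apply: leq_trans (leq_trans h _); rewrite -subn_eq0.
      by apply/eqP; rewrite (_ : n * c1 * (n * c2) * (m * c3) = n * n * (m * (c1 * c2 * c3)))%N ?subnn //; ring.
    by apply/eqP; rewrite (_ : 2 * J * c4 * (2 * J * c5) * (n * n * c6) = n * n * (4 * J ^ 2 * (c4 * c5 * c6)))%N ?subnn // -mulnn; ring.
  by rewrite mulrAC ler_pdivlMr // -natrX -!natrM ler_nat mulnC.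
have Hq : 'C(M, m - (a + b))%:R * 'C(NN n, m)%:R
   <= (1 + 8 / n%:R) ^+ (J + J) * K * ('C(N', m - a)%:R * 'C(N', m - b)%:R) :> R.
  apply: le_trans main _; apply: ler_wpM2r; first by rewrite mulr_ge0.
  exact: ler_wpM2r.
have y0 : 0 <= 1 + 4 * J%:R ^+ 2 / m%:R :> R by rewrite addr_ge0 // divr_ge0 // mulr_ge0 // sqr_ge0.
rewrite /pdeg /pair_factor -/N' -/K.
rewrite ler_pdivrMr //; apply: le_trans cn _.
rewrite !natrM.
have := ler_pM (mulr_ge0 (ler0n _ _) (ler0n _ _)) (mulr_ge0 (ler0n _ _) (ler0n _ _))
  (ler_pM (ler0n _ _) (ler0n _ _) (b1 a) (b1 b)) Hq.
move: ((1 + 8 / n%:R) ^+ (J + J)) (1 + 4 * J%:R ^+ 2 / m%:R) y0 bn0 => P Y y0.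
move: 'C(n - 2, a)%:R 'C(n - 2, b)%:R 'C(M, m - (a + b))%:R 'C(NN n, m)%:R 'C(n.-1, a)%:R 'C(n.-1, b)%:R 'C(N', m - a)%:R 'C(N', m - b)%:R.
move=> c1 c2 c3 c4 c5 c6 c7 c8 c40 h.
have -> : Y * P * K * (c5 * c7 / c4 * (c6 * c8 / c4)) * c4
   = Y * (c5 * c6 * (P * K * (c7 * c8))) / c4.
  by field; exact: lt0r_neq0.
rewrite ler_pdivlMr //.
have -> : Y * (c1 * c2 * c3) * c4 = Y * (c1 * c2 * (c3 * c4)) by ring.
exact: ler_wpM2l.
Qed.
End Pairs.

(** * Exact formulas for the degree law of the hub *)

Lemma bin_mul_trinomial (n a k : nat) : (k <= a <= n)%N ->
  ('C(n, a) * 'C(a, k) = 'C(n, k) * 'C(n - k, a - k))%N.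
Proof.
move=> /andP[ka an].
have f0 : (0 < k`! * (a - k)`! * (n - a)`!)%N by rewrite !muln_gt0 !fact_gt0.
apply/eqP; rewrite -(eqn_pmul2r f0); apply/eqP.
have e1 := bin_fact an; have e2 := bin_fact ka.
have e3 := bin_fact (leq_trans ka an).
have e4 : ('C(n - k, a - k) * ((a - k)`! * (n - a)`!) = (n - k)`!)%N.
  by rewrite (_ : n - a = n - k - (a - k))%N ?bin_fact //; lia.
transitivity ('C(n, a) * (('C(a, k) * (k`! * (a - k)`!)) * (n - a)`!))%N; first by ring.
rewrite e2 e1 -e3 -e4; ring.
Qed.

Lemma bin_ffact_ratio (N m k : nat) : (k <= m <= N)%N ->
  ('C(N, m) * m ^_ k = N ^_ k * 'C(N - k, m - k))%N.
Proof.
elim: k N m => [|k IH] N m /andP[km mN]; first by rewrite !ffactn0 !subn0 muln1 mul1n.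
case: m km mN => // m km; case: N => // N mN.
rewrite !ffactSS !subSS -mulnA -IH; last by apply/andP; split.
by rewrite mulnA [('C(_, _) * _)%N]mulnC -(mul_bin_diag N.+1 m) /=; ring.
Qed.

Section DegreeLaw.
Variables (R : realType) (n m k : nat).
Hypotheses (n1 : (1 < n)%N) (nm : (n <= m)%N) (mN : (n.-1 + m <= NN n)%N).

Local Notation N := (NN n).
Local Notation N' := (NN n - n.-1)%N.
Local Notation p := (pdeg R n m).
Local Notation lm := (lam R n m k).

(** This is the degree law of the hub under the planted distribution: [k] plus a hypergeometric
    variable counting the other edges drawn at the hub. *)
Definition wdeg (a : nat) : R := lm a * p a.

Lemma wdeg_ge0 a : 0 <= wdeg a.
Proof. by rewrite mulr_ge0 ?lam_ge0 ?pdeg_ge0. Qed.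

Lemma pdeg_rec j : (j < n)%N ->
  p j.+1 * ((j.+1)%:R * (N' - m + j.+1)%:R) = p j * ((n.-1 - j)%:R * (m - j)%:R).
Proof.
move=> jn.
have e1 := mul_bin_left n.-1 j.
have e2 := mul_bin_left N' (m - j.+1).
have E : ((m - j.+1).+1 = m - j)%N by lia.
have E' : (N' - (m - j.+1) = N' - m + j.+1)%N by lia.
rewrite E E' in e2.
have e : ('C(n.-1, j.+1) * 'C(N', m - j.+1) * (j.+1 * (N' - m + j.+1))
   = 'C(n.-1, j) * 'C(N', m - j) * ((n.-1 - j) * (m - j)))%N.
  transitivity ((j.+1 * 'C(n.-1, j.+1)) * ((N' - m + j.+1) * 'C(N', m - j.+1)))%N; first by ring.
  rewrite e1 -e2; ring.
by rewrite /pdeg mulrAC [RHS]mulrAC -!natrM e.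
Qed.

Lemma lam_rec j : (k <= j.+1)%N -> lm j.+1 * (j.+1 - k)%:R = lm j * (j.+1)%:R.
Proof.
move=> kj; have e := mul_bin_down j.+1 k; rewrite /= in e.
rewrite /lam mulrAC [RHS]mulrAC -!natrM; congr (_%:R / _).
transitivity ('C(N, m) * ((j.+1 - k) * 'C(j.+1, k)))%N; first by ring.
by rewrite -e; ring.
Qed.

Lemma wdeg_rec j : (k <= j)%N -> (j < n)%N ->
  wdeg j.+1 * ((j.+1 - k)%:R * (N' - m + j.+1)%:R) = wdeg j * ((n.-1 - j)%:R * (m - j)%:R).
Proof.
move=> kj jn; have e1 := pdeg_rec jn; have e2 := lam_rec (leqW kj).
have h : (j.+1)%:R != 0 :> R by rewrite pnatr_eq0.
apply: (mulfI h); rewrite /wdeg.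
transitivity ((lm j.+1 * (j.+1 - k)%:R) * (p j.+1 * ((j.+1)%:R * (N' - m + j.+1)%:R))); first by ring.
by rewrite e1 e2; ring.
Qed.

Lemma wdeg_small j : (j < k)%N -> wdeg j = 0.
Proof. by move=> jk; rewrite /wdeg /lam bin_small // mul0n mul0r mul0r. Qed.

(** Rewriting ['C(n.-1, a) * 'C(a, k)] as ['C(n.-1, k) * 'C(n.-1 - k, a - k)] leaves a Vandermonde
    convolution for ['C(N - k, m - k)], whose terms from index [n - k] on vanish. *)
Lemma sum_wdeg : (k < n)%N -> \sum_(0 <= a < n) wdeg a = 1.
Proof.
move=> kn.
have V := binomial.Vandermonde (n.-1 - k) N' (m - k).
rewrite (_ : n.-1 - k + N' = N - k)%N in V; last by lia.
have V' : (\sum_(0 <= j < n - k) 'C(n.-1 - k, j) * 'C(N', m - k - j) = 'C(N - k, m - k))%N.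
  rewrite -V -(big_mkord xpredT (fun j => 'C(n.-1 - k, j) * 'C(N', m - k - j))%N).
  rewrite [RHS](@big_cat_nat _ _ _ (n - k)) //=; last by lia.
  rewrite [X in (_ + X)%N]big_nat [X in (_ + X)%N]big1 ?addn0 // => i /andP[hi _].
  by rewrite bin_small //; lia.
rewrite (@big_cat_nat _ _ _ k) ?(ltnW kn) //=.
rewrite [X in X + _]big_nat [X in X + _]big1 ?add0r; last first.
  by move=> i /andP[_ ik]; rewrite wdeg_small.
have c1 : 'C(n.-1, k)%:R != 0 :> R by rewrite pnatr_eq0 -lt0n bin_gt0; lia.
have c2 : 'C(N - k, m - k)%:R != 0 :> R by rewrite pnatr_eq0 -lt0n bin_gt0; lia.
have c3 : 'C(N, m)%:R != 0 :> R by rewrite pnatr_eq0 -lt0n bin_gt0; lia.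
transitivity (\sum_(k <= a < n) ('C(n.-1 - k, a - k) * 'C(N', m - a))%:R / 'C(N - k, m - k)%:R : R).
  apply: eq_big_nat => a /andP[ka an].
  have e : ('C(n.-1, a) * 'C(a, k) = 'C(n.-1, k) * 'C(n.-1 - k, a - k))%N.
    by apply: bin_mul_trinomial; lia.
  move/(congr1 (fun t : nat => t%:R : R)): e; rewrite !natrM => e.
  rewrite /wdeg /lam /pdeg !natrM.
  have -> : 'C(n.-1 - k, a - k)%:R = 'C(n.-1, a)%:R * 'C(a, k)%:R / 'C(n.-1, k)%:R :> R.
    by rewrite e mulrAC divff ?mul1r.
  by field; rewrite c1 c2 c3.
rewrite -mulr_suml -natr_sum.
rewrite (_ : \sum_(k <= a < n) 'C(n.-1 - k, a - k) * 'C(N', m - a) = 'C(N - k, m - k))%N ?divff //.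
transitivity (\sum_(0 + k <= a < n) 'C(n.-1 - k, a - k) * 'C(N', m - a))%N; first by rewrite add0n.
rewrite big_addn -V'.
rewrite [LHS]big_nat [RHS]big_nat; apply: eq_bigr => i _.
by rewrite addnK (_ : m - (i + k) = m - k - i)%N //; lia.
Qed.

(** Written with falling factorials, [lam] becomes a product of [k] factors each close to [a/D],
    since [N * D = (n-1) * m]. This is the form that can be exponentiated factor by factor. *)
Lemma lam_prod a : (k <= a)%N -> (k < n)%N ->
  lm a = \prod_(i < k) ((a - i)%:R * (N - i)%:R / ((n.-1 - i)%:R * (m - i)%:R)).
Proof.
move=> ka kn.
rewrite big_split /= prodfV !big_split /= -!natr_prod -!ffact_prod.
have f : k`!%:R != 0 :> R by rewrite pnatr_eq0 -lt0n fact_gt0.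
have e1 := bin_ffact a k; have e2 := bin_ffact n.-1 k.
have e3 : ('C(N, m) * m ^_ k = N ^_ k * 'C(N - k, m - k))%N by apply: bin_ffact_ratio; lia.
move/(congr1 (fun t : nat => t%:R : R)): e3; rewrite !natrM => e3.
have c1 : 'C(n.-1, k)%:R != 0 :> R by rewrite pnatr_eq0 -lt0n bin_gt0; lia.
have c2 : 'C(N - k, m - k)%:R != 0 :> R by rewrite pnatr_eq0 -lt0n bin_gt0; lia.
have c4 : (m ^_ k)%:R != 0 :> R by rewrite pnatr_eq0 -lt0n ffact_gt0; lia.
rewrite -e1 -e2 !natrM /lam !natrM.
have -> : (N ^_ k)%:R = 'C(N, m)%:R * (m ^_ k)%:R / 'C(N - k, m - k)%:R :> R.
  by rewrite e3 mulfK.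
by field; rewrite c1 c2 c4 f.
Qed.
End DegreeLaw.

(** * Weight sequences with controlled ratios, and exponential inequalities *)

Section Sequences.
Variable R : realType.

(** Since [S * (1 + S^-1) = S + 1], passing from [S * w j] to [S * w j.+1] makes room for exactly
    one more term. *)
Lemma sum_le_last (w : nat -> R) (j1 : nat) (S : R) : 0 < S ->
  (forall j, (j < j1)%N -> w j * (1 + S^-1) <= w j.+1) ->
  (forall j, 0 <= w j) -> \sum_(0 <= j < j1) w j <= S * w j1.
Proof.
move=> S0 up w0; elim: j1 up => [|j1 IH] up.
  by rewrite big_nil mulr_ge0 // ltW.
have {}IH := IH (fun j h => up j (ltnW h)).
rewrite big_nat_recr //=.
have h := up j1 (ltnSn _); rewrite -(ler_pM2l S0) in h; apply: le_trans h.
have -> : S * (w j1 * (1 + S^-1)) = S * w j1 + w j1 by field; exact: lt0r_neq0.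
by rewrite lerD2r.
Qed.

Lemma seq_ratio_le (w : nat -> R) (j1 j2 : nat) (d : R) : 0 <= d ->
  (forall j, 0 <= w j) ->
  (forall j, (j1 <= j)%N -> (j < j2)%N -> expR (- d) * w j <= w j.+1) ->
  forall j i, (j1 <= j)%N -> (j <= i)%N -> (i <= j2)%N ->
  w j <= expR (d * (j2 - j1)%:R) * w i.
Proof.
move=> d0 w0 step j i j1j ji ij2.
have h : expR (- d * (i - j)%:R) * w j <= w i.
  rewrite -(subnKC ji); move: ij2; rewrite -{1}(subnKC ji); elim: (i - j)%N => [|t IH] ht.
    by rewrite addn0 subnn mulr0 expR0 mul1r.
  have {}IH := IH ltac:(lia).
  rewrite addnS; apply: le_trans (step (j + t)%N _ _); [|lia|lia].
  have -> : ((j + t).+1 - j = t.+1)%N by lia.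
  have E : (j + t - j = t)%N by lia.
  rewrite E in IH.
  have -> : expR (- d * t.+1%:R) = expR (- d) * expR (- d * t%:R).
    by rewrite -expRD; congr expR; rewrite -natr1; ring.
  by rewrite -mulrA; apply: ler_wpM2l => //; exact: expR_ge0.
have e0 := expR_gt0 (d * (i - j)%:R).
rewrite -(ler_pM2l e0) mulrA -expRD mulNr subrr expR0 mul1r in h.
apply: le_trans h _; apply: ler_wpM2r => //.
by rewrite ler_expR; apply: ler_wpM2l => //; rewrite ler_nat; lia.
Qed.

(* The weights grow geometrically before [j1] and vary by a factor at most [E] between [j1] and
   [J + r], so the window following [J] carries a positive fraction of the total mass. *)
Lemma window_mass (w : nat -> R) (j1 J r n : nat) (S E : R) :
  (forall j, 0 <= w j) -> \sum_(0 <= j < n) w j = 1 ->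
  (j1 <= J)%N -> (0 < r)%N -> (J + r <= n)%N -> 0 < S -> 0 < E ->
  (forall j, (j < j1)%N -> w j * (1 + S^-1) <= w j.+1) ->
  (forall j i, (j1 <= j)%N -> (j <= i)%N -> (i <= J + r)%N -> w j <= E * w i) ->
  \sum_(0 <= j < J) w j <= 1 - (1 + E * (S + (J - j1)%:R) / r%:R)^-1 /\ w J <= E / r%:R.
Proof.
move=> w0 w1 j1J r0 Jr S0 E0 up mid.
have rR : (0 : R) < r%:R by rewrite ltr0n.
set W := \sum_(J <= j < n) w j.
have split1 : \sum_(0 <= j < J) w j + W = 1.
  by rewrite -w1 [RHS](@big_cat_nat _ _ _ J) //; lia.
have W1 : W <= 1 by rewrite -split1 lerDr sumr_ge0.
have pt j : (j1 <= j)%N -> (j <= J)%N -> w j <= E * W / r%:R.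
  move=> j1j jJ; rewrite ler_pdivlMr //.
  apply: (@le_trans _ _ (\sum_(J <= i < J + r) E * w i)).
    have -> : w j * r%:R = \sum_(J <= i < J + r) w j.
      by rewrite sumr_const_nat addKn mulr_natr.
    by apply: ler_sum_nat => i /andP[Ji iJ]; apply: mid => //; lia.
  rewrite -mulr_sumr ler_pM2l // /W (@big_cat_nat _ _ _ (J + r) J n) //=; last by lia.
  by rewrite lerDl sumr_ge0.
split; last first.
  apply: le_trans (pt J j1J (leqnn _)) _.
  by rewrite ler_pM2r ?invr_gt0 // ler_piMr // ltW.
set T := E * _ / _.
have T0 : 0 <= T by rewrite divr_ge0 ?ler0n // mulr_ge0 ?addr_ge0 ?ler0n // ltW.
have low : \sum_(0 <= j < J) w j <= T * W.
  rewrite (@big_cat_nat _ _ _ j1) //=.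
  have -> : T * W = S * (E * W / r%:R) + (J - j1)%:R * (E * W / r%:R) by rewrite /T; ring.
  apply: lerD.
    apply: le_trans (sum_le_last S0 up w0) _.
    by rewrite ler_pM2l //; apply: pt.
  have -> : (J - j1)%:R * (E * W / r%:R) = \sum_(j1 <= j < J) (E * W / r%:R).
    by rewrite sumr_const_nat mulr_natl.
  by apply: ler_sum_nat => i /andP[Ji iJ]; apply: pt => //; lia.
have T1 : 0 < 1 + T by lra.
have hW : (1 + T)^-1 <= W by rewrite -[X in X <= _]mul1r ler_pdivrMr //; lra.
lra.
Qed.

Lemma geometric_tail (p : nat -> R) (J n : nat) (q : R) : (J <= n)%N -> q < 1 ->
  (forall j, 0 <= p j) ->
  (forall j, (J <= j)%N -> (j < n)%N -> p j.+1 <= q * p j) ->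
  \sum_(J <= j < n) p j <= p J / (1 - q).
Proof.
move=> Jn q1 p0 step; have q2 : 0 < 1 - q by rewrite subr_gt0.
rewrite ler_pdivlMr //.
suff : (\sum_(J <= j < n) p j) * (1 - q) + p n <= p J by have := p0 n; lra.
have h : forall t, (J + t <= n)%N -> (\sum_(J <= j < J + t) p j) * (1 - q) + p (J + t)%N <= p J.
  elim=> [|t IH] ht; first by rewrite addn0 big_geq // mul0r add0r.
  have {}IH := IH ltac:(lia).
  have st := step (J + t)%N ltac:(lia) ltac:(lia).
  rewrite addnS big_nat_recr /=; last by lia.
  lra.
by have := h (n - J)%N; rewrite subnKC //; apply.
Qed.

(** With [u] the exponent, [expR u <= 1/(1 - u)], and [(1 + x) * (1 - u) = 1 + x^2 * (1 + 2x)]. The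
    restriction on [x] is exactly [1 + 2x >= 0]. *)
Lemma expR_sub2sqr_le (x : R) : - (2^-1) <= x -> expR (x - 2 * x ^+ 2) <= 1 + x.
Proof.
move=> x1; set u := x - 2 * x ^+ 2.
have u1 : 0 < 1 - u by rewrite /u; nra.
have h : expR u * (1 - u) <= 1.
  have := expR_ge1Dx (- u) => h'.
  by apply: le_trans (ler_wpM2l (expR_ge0 u) h') _; rewrite -expRD subrr expR0.
rewrite -(ler_pM2r u1); apply: le_trans h _.
have -> : (1 + x) * (1 - u) = 1 + x ^+ 2 * (1 + 2 * x) by rewrite /u; ring.
have : 0 <= x ^+ 2 * (1 + 2 * x) by rewrite mulr_ge0 ?sqr_ge0 //; lra.
lra.
Qed.

Lemma expRN2_le (c : R) : 0 <= c -> c <= 2^-1 -> expR (- (2 * c)) <= 1 - c.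
Proof.
move=> c0 c1; have := @expR_sub2sqr_le (- c) ltac:(lra).
apply: le_trans; rewrite ler_expR; nra.
Qed.

Lemma inv_le_expR (c : R) : 0 <= c -> c <= 2^-1 -> (1 - c)^-1 <= expR (2 * c).
Proof.
move=> c0 c1; rewrite -[expR _]invrK -expRN lef_pV2 ?posrE ?expR_gt0 //; last lra.
exact: expRN2_le.
Qed.

(** By [N * D = n1 * m] the quotient equals [(1 + x) * (1 - i/N) / ((1 - i/n1) * (1 - i/m))]. The
    numerator correction costs [2K] in the lower exponent, the two denominators [2K] each in the
    upper one. *)
Lemma lam_factor_bounds (D N n1 m i j K : R) :
  0 < D -> 0 < N -> 0 < n1 -> 0 < m -> N * D = n1 * m -> 0 <= i ->
  2 * i <= n1 -> 2 * i <= m -> 2 * i <= N ->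
  i / n1 <= K -> i / m <= K -> i / N <= K ->
  let x := (j - D - i) / D in - (2^-1) <= x ->
  expR (x - 2 * x ^+ 2 - 2 * K) <= (j - i) * (N - i) / ((n1 - i) * (m - i)) <= expR (x + 4 * K).
Proof.
move=> D0 N0 n0 m0 ND i0 in1 im iN K1 K2 K3 x x1.
have e : (j - i) * (N - i) / ((n1 - i) * (m - i))
   = (1 + x) * (1 - i / N) * ((1 - i / n1)^-1 * (1 - i / m)^-1).
  have -> : (j - i) * (N - i) / ((n1 - i) * (m - i)) = (1 + x) * (1 - i / N) * (N * D) / ((n1 - i) * (m - i)).
    by rewrite /x; field; do !(apply/andP; split); apply/eqP; lra.
  by rewrite ND; field; do !(apply/andP; split); apply/eqP; lra.
have half (z : R) : 0 < z -> 2 * i <= z -> 0 <= i / z /\ i / z <= 2^-1.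
  by move=> z0 iz; rewrite divr_ge0 ?(ltW z0) // ler_pdivrMr //; split => //; lra.
have [N1 N2] := half N N0 iN; have [a1 a2] := half n1 n0 in1; have [b1 b2] := half m m0 im.
have x2 : 0 < 1 + x by lra.
have inv1 (z : R) : 0 <= z -> z <= 2^-1 -> 1 <= (1 - z)^-1.
  by move=> z0 z1; rewrite -[X in X <= _]invr1 lef_pV2 ?posrE; lra.
have A1 := inv1 _ a1 a2; have B1 := inv1 _ b1 b2.
have A2 := inv_le_expR a1 a2; have B2 := inv_le_expR b1 b2.
have N3 := expRN2_le N1 N2.
rewrite e; apply/andP; split.
  have -> : expR (x - 2 * x ^+ 2 - 2 * K) = expR (x - 2 * x ^+ 2) * expR (- (2 * K)) * 1.
    by rewrite mulr1 -expRD; congr expR; ring.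
  apply: ler_pM; rewrite ?ler01 ?mulr_ge0 ?expR_ge0 //.
    apply: ler_pM; [exact: expR_ge0 | exact: expR_ge0 | exact: expR_sub2sqr_le |].
    by apply: le_trans N3; rewrite ler_expR; lra.
  by rewrite -[X in X <= _]mul1r; apply: ler_pM.
have -> : expR (x + 4 * K) = expR x * 1 * (expR (2 * K) * expR (2 * K)).
  by rewrite mulr1 -!expRD; congr expR; ring.
have mon (z : R) : z <= K -> expR (2 * z) <= expR (2 * K) by move=> h; rewrite ler_expR; lra.
apply: ler_pM.
- by rewrite mulr_ge0 //; lra.
- by rewrite mulr_ge0 //; lra.
- by apply: ler_pM; [lra | lra | exact: expR_ge1Dx | lra].
- apply: ler_pM; rewrite ?(le_trans _ A1) ?(le_trans _ B1) //.
  + exact: le_trans A2 (mon _ K1).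
  + exact: le_trans B2 (mon _ K2).
Qed.

Lemma sum_nat_double (k : nat) : 2 * (\sum_(i < k) (i : nat)%:R) = k%:R * (k%:R - 1) :> R.
Proof.
elim: k => [|k IH]; first by rewrite big_ord0 mulr0 mul0r.
by rewrite big_ord_recr /= mulrDr IH -natr1; ring.
Qed.

Lemma csumE_nat (n m k J : nat) : (J <= n)%N ->
  csum R n m k J = \sum_(0 <= a < J) wdeg R n m k a.
Proof.
move=> Jn; rewrite (big_nat_widen _ _ _ _ _ Jn) /= big_mkord.
by apply: eq_bigl.
Qed.

Lemma ptailE_nat (n m J : nat) : ptail R n m J = \sum_(J <= a < n) pdeg R n m a.
Proof. by rewrite big_geq_mkord. Qed.
End Sequences.

(** * Numerical consequences of the asymptotic hypotheses at one large [n] *)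

Section Regime.
Variables (R : realType) (n m k J : nat) (alpha c : R).

Local Notation N := (NN n).
Local Notation L := (ln (n%:R : R)).
Local Notation l := (ln (ln (n%:R : R))).
Local Notation D := (2 * m%:R / n%:R : R).
Local Notation s := (Num.sqrt (2 * m%:R / n%:R : R)).
Local Notation g := (Num.sqrt (2 * ln (n%:R : R))).
Local Notation t := (tstar R alpha n m).
Local Notation y := (t - 2 * m%:R / n%:R).

(* The estimates implied by the asymptotic hypotheses for one large [n]; here [c] depends
   only on [gamma], and [regime_kg] says that [k] lies within [O(s)] of [t - D]. *)
Record regime : Prop := Regime {
  regime_alpha : 1 < alpha;
  regime_c : 1 <= c;
  regime_LB : 40 * c ^+ 2 <= L;
  regime_kL : 40 * c ^+ 2 * L ^+ 2 <= k%:R;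
  regime_kn : k%:R ^+ 2 <= n%:R :> R;
  regime_kD : k%:R ^+ 2 <= 4 * L * D;
  regime_Dk : L * D <= k%:R ^+ 2;
  regime_kg : `|k%:R - g * s| <= c * s;
  regime_J : forall j : nat, (t <= j%:R) = (J <= j)%N }.

Hypothesis H : regime.

Lemma regime_invalpha_gt0 : 0 < alpha^-1.
Proof. have h := regime_alpha H; rewrite invr_gt0; lra. Qed.
Lemma regime_invalpha_lt1 : alpha^-1 < 1.
Proof. have h := regime_alpha H; rewrite invf_lt1 //; lra. Qed.
Lemma regime_sqrc_ge1 : 1 <= c ^+ 2. Proof. by rewrite exprn_ege1 ?(regime_c H). Qed.
Lemma regime_L_ge40 : 40 <= L. Proof. have h := regime_LB H; have h1 := regime_sqrc_ge1; lra. Qed.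
Lemma regime_sqrL_ge1 : 1 <= L ^+ 2. Proof. by rewrite exprn_ege1 //; have h := regime_L_ge40; lra. Qed.
Lemma regime_k_ge_sqrc : 40 * c ^+ 2 <= k%:R.
Proof. have h := regime_kL H; have h1 := regime_sqrc_ge1; have h2 := regime_sqrL_ge1; nra. Qed.
Lemma regime_k_ge40 : 40 <= k%:R :> R. Proof. have h1 := regime_sqrc_ge1; have h2 := regime_k_ge_sqrc; lra. Qed.
Lemma regime_k_le_n : k%:R <= n%:R :> R. Proof. have h1 := regime_kn H; have h2 := regime_k_ge40; nra. Qed.
Lemma regime_n_ge40 : 40 <= n%:R :> R. Proof. have h1 := regime_k_le_n; have h2 := regime_k_ge40; lra. Qed.
Lemma density_ge0 : 0 <= D. Proof. by rewrite divr_ge0 ?mulr_ge0. Qed.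
Lemma density_sqrtK : s ^+ 2 = D. Proof. by rewrite sqr_sqrtr. Qed.
Lemma density_sqrt_ge0 : 0 <= s. Proof. exact: sqrtr_ge0. Qed.
Lemma regime_mE : m%:R = n%:R * D / 2. Proof. have h := regime_n_ge40; field; apply/eqP; lra. Qed.
Lemma regime_sqrg : g ^+ 2 = 2 * L. Proof. by have h := regime_L_ge40; rewrite sqr_sqrtr //; lra. Qed.
Lemma log_sqrt_ge0 : 0 <= g. Proof. exact: sqrtr_ge0. Qed.

Lemma regime_D_ge : 400 * c ^+ 4 * L ^+ 3 <= D.
Proof.
have h100 := regime_kL H; have h101 := regime_kD H; have h102 := regime_sqrc_ge1; have h103 := regime_L_ge40; have h104 := regime_sqrL_ge1.
have h : (40 * c ^+ 2 * L ^+ 2) ^+ 2 <= 4 * L * D.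
  by apply: le_trans (regime_kD H); rewrite ler_sqr ?nnegrE //; nra.
have Lp : 0 < L by lra.
rewrite -(ler_pM2l Lp).
have : 0 <= c ^+ 4 * L ^+ 4.
  by have hc := regime_c H; rewrite mulr_ge0 ?exprn_ge0 //; lra.
have -> : L * (400 * c ^+ 4 * L ^+ 3) = 400 * (c ^+ 4 * L ^+ 4) by ring.
have e : (40 * c ^+ 2 * L ^+ 2) ^+ 2 = 1600 * (c ^+ 4 * L ^+ 4) by ring.
rewrite e in h; move: h; set X := _ ^+ 4 * _ ^+ 4; lra.
Qed.

Lemma regime_s_ge : 20 * c ^+ 2 * L <= s.
Proof.
have h100 := regime_sqrc_ge1; have h101 := regime_L_ge40; have h102 := regime_sqrL_ge1.
rewrite -ler_sqr ?nnegrE ?sqrtr_ge0 //; last by nra.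
rewrite density_sqrtK; apply: le_trans regime_D_ge.
have -> : (20 * c ^+ 2 * L) ^+ 2 = 400 * c ^+ 4 * L ^+ 2 by ring.
have h : 0 <= c ^+ 4 by have hc := regime_c H; rewrite exprn_ge0 //; lra.
have -> : 400 * c ^+ 4 * L ^+ 3 = 400 * c ^+ 4 * L ^+ 2 * L by ring.
have h2 : 0 <= c ^+ 4 * L ^+ 2 by rewrite mulr_ge0 // sqr_ge0.
nra.
Qed.

Lemma regime_s_ge_sqrc : 800 * c ^+ 2 <= s.
Proof.
have h100 := regime_sqrc_ge1; have h101 := regime_L_ge40.
by apply: le_trans regime_s_ge; nra. Qed.
Lemma regime_s_ge800 : 800 <= s. Proof. have h100 := regime_sqrc_ge1; have h101 := regime_s_ge_sqrc. lra. Qed.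
Lemma regime_s_le_D : 800 * s <= D. Proof. by rewrite -[X in _ <= X]density_sqrtK expr2 ler_wpM2r ?regime_s_ge800. Qed.

(** From [40 L^2 k <= k^2 <= 4 L D]: the assumption [(log n)^2 << k] makes the planted shift small
    relative to the mean degree. *)
Lemma regime_k_le_D : 10 * L * k%:R <= D.
Proof.
have h100 := regime_k_ge40; have h101 := regime_sqrc_ge1; have h102 := regime_L_ge40; have h103 := regime_sqrL_ge1; have h104 := regime_kD H.
have k0 : 0 < k%:R :> R by lra.
have : 40 * L ^+ 2 * k%:R <= k%:R ^+ 2.
  rewrite expr2 ler_pM2r //; apply: le_trans (regime_kL H); nra.
have Lp : 0 < L by lra.
rewrite -(ler_pM2l Lp); nra.
Qed.

Lemma regime_DL_n : L * D <= n%:R.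
Proof. exact: le_trans (regime_Dk H) (regime_kn H). Qed.

Lemma regime_N : N%:R = n%:R * (n%:R - 1) / 2 :> R.
Proof.
have h100 := regime_n_ge40.
have e : (n * n.-1 = 2 * NN n)%N by rewrite -(mul_bin_diag n 1) bin1.
have np : (0 < n)%N by rewrite -(ltr0n R); lra.
move/(congr1 (fun t : nat => t%:R : R)): e; rewrite !natrM -subn1 natrB // => e.
by rewrite e; field.
Qed.

Lemma regime_D_le_n : 40 * D <= n%:R.
Proof.
have h100 := regime_L_ge40; have h101 := density_ge0.
by apply: le_trans regime_DL_n; rewrite ler_wpM2r. Qed.

Lemma regime_nats : [/\ (2 < n)%N, (2 * n <= m)%N, (n.-1 + m <= N)%N, (k < n)%N &
  (n * n <= 8 * (N - (n.-1 + (n - 2)) - m))%N].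
Proof.
have h100 := regime_n_ge40; have h101 := regime_D_le_n; have h102 := density_ge0; have h103 := regime_s_le_D; have h104 := regime_s_ge800; have h105 := regime_k_ge40; have h106 := regime_kn H.
have hn : (2 < n)%N by rewrite -(ltr_nat R); lra.
have hN := regime_N.
have nn : 40 * n%:R <= n%:R * n%:R :> R by rewrite ler_wpM2r.
have mn : m%:R <= n%:R * n%:R / 80 :> R.
  have : n%:R * (40 * D) <= n%:R * n%:R by rewrite ler_wpM2l.
  have e := regime_mE; move: e; set d := D; lra.
have hN2 : N%:R = n%:R * n%:R / 2 - n%:R / 2 :> R by rewrite hN; field.
clear h101 h102 h103 h104 h105 h106.
split => //.
- rewrite -(ler_nat R) natrM regime_mE.
  have : n%:R * 800 <= n%:R * D :> R.
    apply: ler_wpM2l; first exact: ler0n.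
    by have d1 := regime_s_le_D; have d2 := regime_s_ge800; lra.
  set d := D; lra.
- have hp : n.-1%:R = n%:R - 1 :> R by rewrite -subn1 natrB //; exact: ltnW (ltnW hn).
  by rewrite -(ler_nat R) natrD hp hN2; lra.
- rewrite -(ltr_nat R); have := regime_kn H; have := regime_k_ge40; nra.
- have h : (n * n + 8 * (2 * n + m) <= 8 * N)%N.
    rewrite -(ler_nat R) !(natrD, natrM) hN2.
    lra.
  clear -h; lia.
Qed.

Local Notation theta := (1 - m%:R / N%:R : R).

Lemma regime_mN : m%:R / N%:R = D / (n%:R - 1).
Proof.
have h100 := regime_n_ge40.
rewrite regime_N; field; apply/andP; split; apply/eqP; lra. Qed.

Lemma regime_mN_ge0 : 0 <= D / (n%:R - 1). Proof. have h100 := regime_n_ge40. rewrite divr_ge0 //; lra. Qed.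
Lemma regime_LmN_le2 : L * (D / (n%:R - 1)) <= 2.
Proof.
have h100 := regime_n_ge40.
rewrite mulrA ler_pdivrMr; last lra. have := regime_DL_n; lra. Qed.
Lemma regime_loglog_ge0 : 0 <= l. Proof. have h100 := regime_L_ge40. by apply: ln_ge0; lra. Qed.

Lemma regime_loglog_le_sqrt : l <= 2 * Num.sqrt L - 2.
Proof.
have h100 := regime_L_ge40.
have h : 0 < Num.sqrt L by rewrite sqrtr_gt0; lra.
have e : L = Num.sqrt L ^+ 2 by rewrite sqr_sqrtr //; lra.
rewrite {1}e lnXn // mulr2n.
have := le_ln1Dx (_ : - 1 < Num.sqrt L - 1); rewrite addrCA subrr addr0 => h2.
have := h2 ltac:(lra); lra.
Qed.

Lemma regime_sqrtL_ge6 : 6 <= Num.sqrt L.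
Proof.
have h100 := regime_L_ge40.
rewrite -(@ler_pXn2r _ 2) ?nnegrE ?sqrtr_ge0 // sqr_sqrtr; lra. Qed.

Lemma regime_loglog_le : l <= L.
Proof.
have h100 := regime_L_ge40.
have e : L = Num.sqrt L ^+ 2 by rewrite sqr_sqrtr //; lra.
move: regime_loglog_le_sqrt regime_sqrtL_ge6 e; set q := Num.sqrt L => h1 h2 e; nra.
Qed.

Lemma regime_radicand_ge0 : 0 <= 2 * L - alpha^-1 * l.
Proof.
have h100 := regime_loglog_ge0; have h101 := regime_loglog_le; have h102 := regime_L_ge40; have h103 := regime_invalpha_gt0; have h104 := regime_invalpha_lt1.
have := regime_loglog_ge0; nra. Qed.

Lemma regime_mN_le1 : D / (n%:R - 1) <= 1.
Proof.
have h100 := regime_L_ge40; have h101 := regime_mN_ge0; have h102 := regime_LmN_le2.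
move: regime_LmN_le2 regime_mN_ge0; set q := D / _; nra. Qed.

Lemma regime_y2 : y ^+ 2 = D * (theta * (2 * L - alpha^-1 * l)).
Proof.
have h100 := regime_mN_le1; have h101 := regime_radicand_ge0.
have -> : y = Num.sqrt (D * (1 - m%:R / N%:R)) * Num.sqrt (2 * L - alpha^-1 * l).
  by rewrite /tstar addrC addKr.
rewrite exprMn !sqr_sqrtr //; first by rewrite mulrA.
by rewrite mulr_ge0 // regime_mN; lra.
Qed.

Lemma tstar_excess_ge0 : 0 <= y.
Proof. by rewrite /tstar addrC addKr mulr_ge0 // sqrtr_ge0. Qed.

Lemma regime_y2_le : theta * (2 * L - alpha^-1 * l) <= 2 * L - alpha^-1 * l.
Proof.
have h := regime_mN_ge0; rewrite regime_mN; apply: ler_piMl; [exact: regime_radicand_ge0 | lra].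
Qed.

Lemma regime_y_le : y <= g * s.
Proof.
have h100 := density_ge0; have h101 := tstar_excess_ge0; have h102 := log_sqrt_ge0; have h103 := density_sqrt_ge0; have h104 := regime_loglog_ge0; have h105 := regime_invalpha_gt0.
rewrite -(@ler_pXn2r _ 2) ?nnegrE ?mulr_ge0 // regime_y2 exprMn regime_sqrg density_sqrtK [X in _ <= X]mulrC.
apply: ler_wpM2l => //.
have h : 0 <= alpha^-1 * l by rewrite mulr_ge0 // ltW.
by apply: (le_trans regime_y2_le); lra.
Qed.

(** The factor [1 - m/N] costs at most [2 L m/N], and [L m/N = L D/(n-1) <= 2] because
    [L D <= k^2 <= n]. *)
Lemma regime_y2_ge : 2 * L - alpha^-1 * l - 4 <= theta * (2 * L - alpha^-1 * l).
Proof.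
have h100 := regime_loglog_ge0; have h101 := regime_invalpha_gt0; have h102 := regime_L_ge40.
rewrite regime_mN.
have h : 0 <= alpha^-1 * l by rewrite mulr_ge0 // ltW.
have hz := mulr_ge0 regime_mN_ge0 h.
move: regime_mN_ge0 regime_LmN_le2 h hz; set q := D / _; set z := alpha^-1 * l; lra.
Qed.

(** Here [(g - 1)^2 = 2L - 2g + 1], so a loss [log log n + 4] in the radicand must fit into
    [2g - 1]. It does, because [log log n <= 2 sqrt L - 2] while [g >= (7/5) sqrt L]. *)
Lemma regime_y_ge : g * s - s <= y.
Proof.
have h100 := density_ge0; have h101 := tstar_excess_ge0; have h102 := log_sqrt_ge0; have h103 := density_sqrt_ge0; have h104 := regime_loglog_ge0; have h105 := regime_invalpha_gt0; have h106 := regime_invalpha_lt1; have h107 := regime_L_ge40.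
have g1 : 1 <= g by rewrite -(@ler_pXn2r _ 2) ?nnegrE // regime_sqrg; lra.
rewrite -(@ler_pXn2r _ 2) ?nnegrE //; last by have := density_sqrt_ge0; nra.
rewrite regime_y2 -{2}(mul1r s) -mulrBl exprMn density_sqrtK mulrC.
apply: ler_wpM2l => //; apply: le_trans regime_y2_ge.
have h : alpha^-1 * l <= l by rewrite ler_piMl // ltW.
have hg : Num.sqrt L * (7 / 5) <= g.
  rewrite -(@ler_pXn2r _ 2) ?nnegrE // ?mulr_ge0 ?sqrtr_ge0 //.
  rewrite exprMn regime_sqrg sqr_sqrtr; lra.
have -> : (g - 1) ^+ 2 = g ^+ 2 - 2 * g + 1 by ring.
rewrite regime_sqrg.
move: regime_loglog_le_sqrt regime_sqrtL_ge6; lra.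
Qed.

Lemma regime_g_ge : 8 * c <= g.
Proof.
have h := regime_c H; have h1 := regime_LB H; have h2 := regime_sqrc_ge1.
have e : (8 * c) ^+ 2 = 64 * c ^+ 2 by ring.
by rewrite -(@ler_pXn2r _ 2) ?nnegrE // ?regime_sqrg ?e; lra.
Qed.

Lemma regime_J_ceil : t <= J%:R /\ J%:R < t + 1.
Proof.
have h100 := tstar_excess_ge0; have h101 := density_ge0; have h102 := regime_s_ge800; have h103 := regime_s_le_D.
have tp : 0 < t by have := tstar_excess_ge0; lra.
split; first by rewrite (regime_J H).
case: J (regime_J H) => [|j] H'; first by have := H' 0%N; rewrite leqnn => h; lra.
have := H' j; rewrite ltnn => /negbT; rewrite -ltNge -natr1; lra.
Qed.
End Regime.

(** * Size of the likelihood weight at the threshold *)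

(** The exponent [e] is the sum of the relative excesses [x i] of the [k] factors. Since [n - 1],
    [m] and [N] are all at least [n/2], [K = 2k/n] serves for the three corrections, with
    [k * K <= 2]. The quadratic terms sum to at most [8 k^3/d^2 <= 4]. Hence the error
    [4 + 2kK <= 8] below and [4kK <= 8] above. *)
Lemma lam_prod_bounds (R : realType) (n m k J : nat) (d : R) :
  (2 < n)%N -> (2 * n <= m)%N -> (n.-1 + m <= NN n)%N -> (k < n)%N ->
  (NN n)%:R * d = (n%:R - 1) * m%:R -> k%:R <= J%:R :> R ->
  0 <= J%:R - d -> J%:R - d <= 2 * k%:R -> 400 * k%:R <= d -> 0 < d ->
  40 * k%:R <= n%:R :> R -> k%:R ^+ 2 <= n%:R :> R -> 2 * k%:R ^+ 3 <= d ^+ 2 ->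
  forall e : R, e = (k%:R * (J%:R - d) - k%:R * (k%:R - 1) / 2) / d ->
  expR (e - 8) <= lam R n m k J <= expR (e + 8).
Proof.
move=> n2 nm mN kn ND kJ u0 u2 kD Dp kn40 kk k3 e eE.
have n1 : (1 < n)%N by exact: ltnW.
have nm' : (n <= m)%N by apply: leq_trans nm; rewrite leq_pmull.
have kJn : (k <= J)%N by rewrite -(ler_nat R).
have n0 : 2 < n%:R :> R by rewrite ltr_nat.
have hp : n.-1%:R = n%:R - 1 :> R by rewrite -subn1 natrB //; exact: ltnW.
have nmR : 2 * n%:R <= m%:R :> R by rewrite -natrM ler_nat.
have mNR : n%:R - 1 + m%:R <= (NN n)%:R :> R by rewrite -hp -natrD ler_nat.
pose K : R := 2 * k%:R / n%:R.
have np : (0 : R) < n%:R by lra.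
have kp : 0 <= k%:R :> R by rewrite ler0n.
have kK : k%:R * K <= 2.
  by rewrite /K mulrA ler_pdivrMr // mulrCA -expr2; lra.
have K0 : 0 <= K by rewrite divr_ge0 // mulr_ge0.
have Kn (z : R) : 0 < z -> n%:R <= 2 * z -> k%:R / z <= K.
  move=> z0 nz; rewrite ler_pdivrMr // /K mulrAC ler_pdivlMr //.
  by rewrite [_ * z]mulrAC mulrC; apply: ler_wpM2r.
pose x (i : nat) : R := (J%:R - d - i%:R) / d.
have fac (i : 'I_k) : expR (x i - 2 * x i ^+ 2 - 2 * K) <=
   (J - i)%:R * (NN n - i)%:R / ((n.-1 - i)%:R * (m - i)%:R) <= expR (x i + 4 * K).
  have ik : (i < k)%N := ltn_ord i.
  have ikR : i%:R <= k%:R :> R by rewrite ler_nat ltnW.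
  have iR : 0 <= i%:R :> R by rewrite ler0n.
  have i1 : (i <= J)%N by clear -ik kJn; lia.
  have i2 : (i <= NN n)%N by clear -ik kn nm mN; lia.
  have i3 : (i <= n.-1)%N by clear -ik kn; lia.
  have i4 : (i <= m)%N by clear -ik kn nm; lia.
  rewrite (natrB _ i1) (natrB _ i2) (natrB _ i3) (natrB _ i4) hp.
  have N0 : 0 < (NN n)%:R :> R by lra.
  have n10 : 0 < n%:R - 1 :> R by lra.
  have m0 : 0 < m%:R :> R by lra.
  have iK (z : R) : 0 < z -> n%:R <= 2 * z -> i%:R / z <= K.
    by move=> z0 nz; apply: le_trans (Kn z z0 nz); rewrite ler_pM2r ?invr_gt0.
  have h1 : 2 * i%:R <= n%:R - 1 :> R by lra.
  have h2 : 2 * i%:R <= m%:R :> R by lra.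
  have h3 : 2 * i%:R <= (NN n)%:R :> R by lra.
  have h4 : i%:R / (n%:R - 1) <= K by apply: iK => //; lra.
  have h5 : i%:R / m%:R <= K by apply: iK => //; lra.
  have h6 : i%:R / (NN n)%:R <= K by apply: iK => //; lra.
  apply: (lam_factor_bounds Dp N0 n10 m0 ND iR h1 h2 h3 h4 h5 h6).
  by rewrite ler_pdivlMr //; lra.
have sx : \sum_(i < k) x i = e.
  rewrite eE -sum_nat_double /x -mulr_suml sumrB sumr_const card_ord -[_ *+ k]mulr_natl.
  by congr (_ / _); field.
have sx2 : \sum_(i < k) (2 * x i ^+ 2) <= 4.
  apply: (@le_trans _ _ (\sum_(i < k) (8 * k%:R ^+ 2 / d ^+ 2))).
    apply: ler_sum => i _; rewrite /x exprMn exprVn mulrA ler_pM2r ?invr_gt0 ?exprn_gt0 //.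
    have ikR : i%:R <= k%:R :> R by rewrite ler_nat ltnW.
    have iR : 0 <= i%:R :> R by rewrite ler0n.
    have hh : `|J%:R - d - i%:R| <= 2 * k%:R by rewrite ler_norml; apply/andP; split; lra.
    rewrite -(ler_sqr) ?nnegrE ?normr_ge0 ?mulr_ge0 // real_normK ?num_real // exprMn in hh.
    lra.
  rewrite sumr_const card_ord -[_ *+ k]mulr_natl mulrA ler_pdivrMr ?exprn_gt0 //.
  have -> : k%:R * (8 * k%:R ^+ 2) = 4 * (2 * k%:R ^+ 3) :> R by ring.
  by rewrite ler_pM2l.
rewrite (lam_prod R n1 nm' mN kJn kn); apply/andP; split.
  apply: (@le_trans _ _ (\prod_(i < k) expR (x i - 2 * x i ^+ 2 - 2 * K))); last first.
    by apply: ler_prod => i _; rewrite expR_ge0; case/andP: (fac i).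
  rewrite -expR_sum ler_expR !sumrB sumr_const card_ord -[_ *+ k]mulr_natl sx.
  lra.
apply: (@le_trans _ _ (\prod_(i < k) expR (x i + 4 * K))).
  apply: ler_prod => i _; have /andP[h1 ->] := fac i.
  by rewrite (le_trans _ h1) ?expR_ge0.
rewrite -expR_sum ler_expR big_split /= sumr_const card_ord -[_ *+ k]mulr_natl sx.
by rewrite [k%:R * (4 * K)]mulrCA; move: kK; move: (k%:R * K) => q hq; lra.
Qed.

Section LamBounds.
Variables (R : realType) (n m k J : nat) (alpha c : R).
Local Notation L := (ln (n%:R : R)).
Local Notation l := (ln (ln (n%:R : R))).
Local Notation D := (2 * m%:R / n%:R : R).
Local Notation s := (Num.sqrt (2 * m%:R / n%:R : R)).
Local Notation g := (Num.sqrt (2 * ln (n%:R : R))).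
Local Notation t := (tstar R alpha n m).

(** Both [t - D] and [k] are close to [g * s]: the former within [s], the latter within [c * s].
    Rounding up to [J] adds at most [1 <= s], whence the constant [c + 2]. *)
Lemma regime_kJ : regime n m k J alpha c ->
  [/\ k%:R <= J%:R :> R, 0 <= J%:R - D, J%:R - D <= 2 * k%:R :> R,
     400 * k%:R <= D & (J%:R - D - k%:R) ^+ 2 <= (c + 2) ^+ 2 * D].
Proof.
move=> H.
have [t1 t2] := regime_J_ceil H.
have y1 := regime_y_le H; have y2 := regime_y_ge H; have y0 := tstar_excess_ge0 n m alpha.
have kg := regime_kg H; move: kg; rewrite ler_norml => /andP[kg1 kg2].
have g8 := regime_g_ge H; have c1 := regime_c H; have s2 := regime_s_ge800 H; have D1 := regime_s_le_D H.
have L1 := regime_L_ge40 H; have ss := density_sqrtK R n m.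
have kD := regime_k_le_D H.
have gs : 8 * (c * s) <= g * s by rewrite mulrA ler_wpM2r // ; lra.
have cs : s <= c * s by rewrite ler_peMl //; lra.
have kD' : 400 * k%:R <= D by apply: le_trans kD; rewrite ler_wpM2r //; lra.
split; [lra | lra | lra | exact: kD' |].
rewrite -[X in _ <= _ * X]ss -exprMn -[X in X <= _]real_normK ?num_real //.
rewrite ler_sqr ?nnegrE ?mulr_ge0 //; last by lra.
move: kg1 kg2 y1 y2 t1 t2 s2; set q := s; set y := g * q; set d := D => *.
by rewrite ler_norml; apply/andP; split; lra.
Qed.

(* Completing the square, [(k (J - D) - k^2/2) / D] is [(t - D)^2 / (2D)] up to
   [(J - D - k)^2 / (2D) = O(1)], and the threshold is designed so that the former is
   [log n - log log n / (2 alpha)] up to [O(1)]. *)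
Lemma regime_lam_bounds : regime n m k J alpha c ->
  expR (L - alpha^-1 * l / 2 - ((c + 2) ^+ 2 / 2 + 10)) <= lam R n m k J
    <= expR (L - alpha^-1 * l / 2 + 9).
Proof.
move=> H.
have [kJ u0 u2 kD uk] := regime_kJ H.
have [n2 nm mN kn _] := regime_nats H.
have [t1 t2] := regime_J_ceil H.
have k10 := regime_k_ge40 H; have n0 := regime_n_ge40 H.
have ND : (NN n)%:R * D = (n%:R - 1) * m%:R :> R.
  by rewrite (regime_N H); field; apply/eqP; lra.
have kk : k%:R ^+ 2 <= n%:R :> R := regime_kn H.
have kn40 : 40 * k%:R <= n%:R :> R.
  by apply: le_trans kk; rewrite expr2 ler_wpM2r.
have kL : 40 * L ^+ 2 <= k%:R.
  apply: le_trans (regime_kL H); rewrite -mulrA ler_wpM2l //.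
  by rewrite ler_peMl ?sqr_ge0 // (regime_sqrc_ge1 H).
have L1 := regime_L_ge40 H; have kDL := regime_kD H.
have y2E := regime_y2 H; have y2ge := regime_y2_ge H; have y2le := regime_y2_le H.
have yy := tstar_excess_ge0 n m alpha.
move: (lam R n m k J) (@lam_prod_bounds R n m k J D n2 nm mN kn ND kJ u0 u2 kD) => la.
move: ND u0 u2 kD uk kDL y2E y2ge y2le yy t1 t2.
set A := (_ * (2 * L - _)); set z := alpha^-1 * l; set d := D; set w := tstar _ _ _ _.
move: A z d w (L) kL L1 => A z d w LL kL L1.
move=> ND u0 u2 kD uk kDL y2E y2ge y2le yy t1 t2 main.
have dp : 0 < d by lra.
(* This uses [(log n)^2 << k]: since [d] is of order [k^2 / log n], the quotient [k^3/d^2] is of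
   order [(log n)^2 / k]. *)
have k3 : 2 * k%:R ^+ 3 <= d ^+ 2.
  have h1 : (k%:R ^+ 2) ^+ 2 <= (4 * LL * d) ^+ 2.
    by rewrite ler_sqr ?nnegrE ?sqr_ge0 // !mulr_ge0 //; lra.
  have h2 : 40 * (2 * k%:R ^+ 3) * LL ^+ 2 <= 2 * k%:R ^+ 4.
    have -> : 40 * (2 * k%:R ^+ 3) * LL ^+ 2 = 2 * k%:R ^+ 3 * (40 * LL ^+ 2) by ring.
    have -> : 2 * k%:R ^+ 4 = 2 * k%:R ^+ 3 * k%:R :> R by ring.
    by rewrite ler_wpM2l // mulr_ge0 // exprn_ge0.
  have LL2 : 0 < LL ^+ 2 by rewrite exprn_gt0 //; lra.
  rewrite -(ler_pM2r LL2).
  have e1 : (4 * LL * d) ^+ 2 = 16 * (d ^+ 2 * LL ^+ 2) by ring.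
  have e2 : (k%:R ^+ 2) ^+ 2 = k%:R ^+ 4 :> R by ring.
  have PQ : 0 <= d ^+ 2 * LL ^+ 2 by rewrite mulr_ge0 ?sqr_ge0.
  rewrite e1 e2 in h1; clear -h1 h2 PQ; lra.
have /andP[lo hi] := main dp kn40 kk k3 _ erefl.
have d0 : d != 0 by rewrite gt_eqF.
(* The square is completed around [J] for the lower bound, where [(J - d)^2 >= (w - d)^2] and
   [(J - d - k)^2] is [O(d)], and around the threshold [w] for the upper one, where rounding costs
   only [2k(J - w) <= 2k]. To the [8] of the product, the lower bound adds [2] for the factor
   [1 - m/N] and the upper one adds [1]. *)
have e1 : (k%:R * (J%:R - d) - k%:R * (k%:R - 1) / 2) / d
   = ((J%:R - d) ^+ 2 - (J%:R - d - k%:R) ^+ 2 + k%:R) / d / 2 by field.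
have e2 : (k%:R * (J%:R - d) - k%:R * (k%:R - 1) / 2) / d
   = ((w - d) ^+ 2 - (w - d - k%:R) ^+ 2 + k%:R + 2 * k%:R * (J%:R - w)) / d / 2 by field.
apply/andP; split.
  apply: le_trans lo; rewrite ler_expR e1.
  suff : A - (c + 2) ^+ 2 <= ((J%:R - d) ^+ 2 - (J%:R - d - k%:R) ^+ 2 + k%:R) / d by lra.
  rewrite ler_pdivlMr // mulrBl [A * d]mulrC -y2E.
  have : (w - d) ^+ 2 <= (J%:R - d) ^+ 2 by rewrite ler_sqr ?nnegrE //; lra.
  lra.
apply: (le_trans hi); rewrite ler_expR e2.
suff : ((w - d) ^+ 2 - (w - d - k%:R) ^+ 2 + k%:R + 2 * k%:R * (J%:R - w)) / d <= A + 2 by lra.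
have eA : (A + 2) * d = (w - d) ^+ 2 + 2 * d by rewrite y2E; ring.
rewrite ler_pdivrMr // eA.
have h1 : 0 <= (w - d - k%:R) ^+ 2 by exact: sqr_ge0.
have h2 : 2 * k%:R * (J%:R - w) <= 2 * k%:R * 1 by rewrite ler_wpM2l //; lra.
lra.
Qed.
End LamBounds.

(* [p] and [(n - 1 - j) * (m - j)] are the denominator and the numerator of the ratio of
   consecutive hub degree probabilities at [j] and [j + 1]. *)
Lemma drift_arith (R : realType) (N n m j k d s : R) :
  N = n * (n - 1) / 2 -> m = n * d / 2 -> s ^+ 2 = d -> 800 <= s -> 6 * s <= k ->
  400 * k <= d -> 40 * d <= n -> k ^+ 2 <= n -> k <= j -> j <= n - 1 ->
  let p := (j + 1 - k) * (N - (m + n - 2 - j)) in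
  let b := (k - 1) * (m + n - 1 - j) + (j - k + 1) in
  [/\ 0 < p, p <= (j + 1 - k) * N, (j + 1 - k) * N <= 2 * p, 0 <= b <= 3 * (s * N)
    & (n - 1 - j) * (m - j) = p - (j - k - d + 1) * N - b].
Proof.
move=> Nn md ss s800 sk kd dn kk kj jn p b.
have k1 : 1 <= k by lra.
have n40 : 40 <= n by lra.
have nn : 40 * n <= n * n by apply: ler_wpM2r; lra.
have nd : n * (40 * d) <= n * n by apply: ler_wpM2l; lra.
have m1 : 1 <= m.
  have : n * 400 <= n * d by apply: ler_wpM2l; lra.
  by clear -md n40; lra.
have N4 : n * n / 4 <= N by clear -Nn nn n40; lra.
have half : 2 * (m + n) <= N by clear -Nn md nd nn n40; lra.
have N0 : 0 < N by clear -N4 nn n40; lra.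
have sN : N <= s * N by rewrite ler_peMl //; lra.
have q0 : 0 < j + 1 - k by lra.
have X0 : 0 < N - (m + n - 2 - j) by clear -half k1 kj N0; lra.
have X1 : N - (m + n - 2 - j) <= N.
  by clear -jn m1; lra.
have X2 : N <= 2 * (N - (m + n - 2 - j)) by clear -half k1 kj; lra.
split.
- exact: mulr_gt0.
- by rewrite /p ler_pM2l.
- by rewrite /p [X in _ <= X]mulrCA ler_pM2l.
- have h1 : 0 <= (k - 1) * (m + n - 1 - j) by apply: mulr_ge0; lra.
  have h2 : (k - 1) * (m + n - 1 - j) <= k * (m + n) by apply: ler_pM; lra.
  have h3 : k * n <= N.
    have : 40 * k * n <= n * n by apply: ler_wpM2r; lra.
    by clear -N4 nn n40; lra.
  (* With [m = n s^2 / 2], the product [k * m] contains [s * k], and [6 s k <= k^2 <= n]. *)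
  have h4 : k * m <= s * N.
    have e : k * m = (s * k) * (n * s) / 2 by rewrite md -ss; field.
    have f : s * k <= n / 6.
      have : 6 * s * k <= k * k by apply: ler_wpM2r; lra.
      by rewrite -expr2; lra.
    have f2 : s * k * (n * s) <= n / 6 * (n * s).
      by apply: ler_wpM2r => //; apply: mulr_ge0; lra.
    have f3 : s * (n * n / 4) <= s * N by rewrite ler_pM2l //; lra.
    have f4 : 0 <= s * (n * n) by apply: mulr_ge0; [lra | apply: mulr_ge0; lra].
    by clear -e f2 f3 f4; lra.
  have h5 : n <= N by clear -N4 nn n40; lra.
  rewrite /b; clear -h1 h2 h3 h4 h5 sN kj jn k1; apply/andP; split; lra.
- have ND : N * d = (n - 1) * m by rewrite Nn md; field.
  by rewrite /p /b; clear -ND; lra.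
Qed.

(** * Shape of the hub degree law around its centre [d + k] *)

Section HubDegree.
Variables (R : realType) (n m k : nat) (d s c : R).
Local Notation N := ((NN n)%:R : R).

(* [d] and [s] stand for [2m/n] and its square root. *)
Record scaling : Prop := Scaling {
  scaling_n : (2 < n)%N;
  scaling_nm : (2 * n <= m)%N;
  scaling_mN : (n.-1 + m <= NN n)%N;
  scaling_kn : (k < n)%N;
  scaling_N : N = n%:R * (n%:R - 1) / 2;
  scaling_m : m%:R = n%:R * d / 2;
  scaling_s : s ^+ 2 = d;
  scaling_c : 1 <= c;
  scaling_cs : 800 * c <= s;
  scaling_k : 400 * k%:R <= d;
  scaling_sk : 6 * s <= k%:R;
  scaling_kk : k%:R ^+ 2 <= n%:R :> R;
  scaling_dn : 40 * d <= n%:R }.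

Hypothesis H : scaling.

(** The recurrence in drift form: with [p] comparable to [(j + 1 - k) * N], the relative increment
    at [j] is governed by the distance from [j] to [d + k], up to an error [b] worth at most [3s]
    units of that distance. *)
Lemma wdeg_drift j : (k <= j)%N -> (j < n)%N ->
  exists2 p : R, [/\ 0 < p, p <= (j.+1%:R - k%:R) * N &
      (j.+1%:R - k%:R) * N <= 2 * p] &
    exists2 b : R, 0 <= b <= 3 * (s * N) &
      wdeg R n m k j.+1 * p = wdeg R n m k j * (p - (j%:R - k%:R - d + 1) * N - b).
Proof.
move=> kj jn.
case: H => n2 nm mN kn Nn md ss c1 cs kd sk kk dn.
have n1 : (1 < n)%N by exact: ltnW.
have nm' : (n <= m)%N by apply: leq_trans nm; rewrite leq_pmull.
have rec := wdeg_rec R n1 nm' mN kj jn.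
have jm : (j <= m)%N by apply: leq_trans nm'; exact: ltnW.
have jn1 : (j <= n.-1)%N by clear -jn; lia.
have e1 : (j.+1 - k)%:R = j.+1%:R - k%:R :> R by rewrite natrB // leqW.
have e2 : (NN n - n.-1 - m + j.+1)%:R = N - (m%:R + n%:R - 2 - j%:R) :> R.
  have hp : n.-1%:R = n%:R - 1 :> R by rewrite -subn1 natrB //; exact: ltnW.
  rewrite natrD !natrB ?hp -?natr1; first by ring.
    by clear -mN; lia.
  by clear -mN; lia.
have e3 : (n.-1 - j)%:R = n%:R - 1 - j%:R :> R.
  by rewrite natrB // -subn1 natrB //; exact: ltnW.
have e4 : (m - j)%:R = m%:R - j%:R :> R by rewrite natrB.
rewrite e1 e2 e3 e4 in rec.
have kR : k%:R <= j%:R :> R by rewrite ler_nat.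
have jR : j%:R <= n%:R - 1 :> R.
  by rewrite -[1]/(1%:R) -natrB ?ler_nat ?subn1 //; exact: ltnW.
have k0 : 0 <= k%:R :> R by rewrite ler0n.
rewrite -natr1 in rec *.
have h800 : 800 <= s by lra.
have [p0 p1 p2 p3 e5] := drift_arith Nn md ss h800 sk kd dn kk kR jR.
exists ((j%:R + 1 - k%:R) * (N - (m%:R + n%:R - 2 - j%:R))); first by [].
exists ((k%:R - 1) * (m%:R + n%:R - 1 - j%:R) + (j%:R - k%:R + 1)); first by [].
by rewrite -e5.
Qed.
End HubDegree.

Lemma scaling_gt0 (R : realType) (n m k : nat) (d s c : R) : scaling n m k d s c ->
  0 < (NN n)%:R :> R /\ 800 <= s.
Proof.
move=> H.
have Nn := scaling_N H; have c1 := scaling_c H; have cs := scaling_cs H; have kd := scaling_k H.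
have sk := scaling_sk H; have dn := scaling_dn H.
have s8 : 800 <= s by clear -c1 cs; lra.
have n40 : 40 <= n%:R :> R by clear -s8 sk kd dn; lra.
by split => //; rewrite Nn divr_gt0 // mulr_gt0 //; clear -n40; lra.
Qed.

(** At distance [5s] below the centre, the drift [5sN] exceeds the losses [b <= 3sN] and [N] by at
    least [sN], and [p/s <= dN/s = sN]. Below [k] the weight is zero. *)
Lemma wdeg_up (R : realType) (n m k : nat) (d s c : R) j : scaling n m k d s c ->
  (j < n)%N -> j%:R - k%:R - d <= - (5 * s) ->
  wdeg R n m k j * (1 + s^-1) <= wdeg R n m k j.+1.
Proof.
move=> H jn hz; have [N0 s8] := scaling_gt0 H.
have [jk|kj] := ltnP j k; first by rewrite wdeg_small // mul0r wdeg_ge0.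
have [p [p0 p1 p2] [b /andP[b0 b1] e]] := wdeg_drift H kj jn.
have s0 : 0 < s by clear -s8; lra.
have ss := scaling_s H.
rewrite -(ler_pM2r p0) e -mulrA; apply: ler_wpM2l; first exact: wdeg_ge0.
have h1 : (1 + s^-1) * p = p + p / s by field; rewrite gt_eqF.
have h2 : p / s <= s * (NN n)%:R.
  rewrite ler_pdivrMr // mulrAC -expr2 ss; apply: le_trans p1 _.
  by rewrite ler_pM2r // -natr1; clear -hz s8; lra.
have h3 : (j%:R - k%:R - d + 1) * (NN n)%:R <= (1 - 5 * s) * (NN n)%:R.
  by rewrite ler_pM2r //; clear -hz; lra.
have h4 : (NN n)%:R <= s * (NN n)%:R by rewrite ler_peMl //; clear -s8; lra.
by rewrite h1; clear -h2 h3 h4 b1; lra.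
Qed.

(** The relative decrease is at most [((c+3)s + 1 + 3s) N / p], and [p >= dN/4] by the lower bound
    on [j]; this gives [q = 4(c+7)/s]. Passing from [1 - q] to an exponential doubles the
    constant. *)
Lemma wdeg_down (R : realType) (n m k : nat) (d s c : R) j : scaling n m k d s c ->
  (k <= j)%N -> (j < n)%N -> - (d / 2) <= j%:R - k%:R - d ->
  j%:R - k%:R - d <= (c + 3) * s ->
  expR (- (8 * (c + 7) / s)) * wdeg R n m k j <= wdeg R n m k j.+1.
Proof.
move=> H kj jn hz1 hz2; have [N0 s8] := scaling_gt0 H.
have [p [p0 p1 p2] [b /andP[b0 b1] e]] := wdeg_drift H kj jn.
have s0 : 0 < s by clear -s8; lra.
have ss := scaling_s H; have c1 := scaling_c H; have cs := scaling_cs H.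
pose q := 4 * (c + 7) / s.
have q0 : 0 <= q by rewrite divr_ge0 ?(ltW s0) // mulr_ge0 //; clear -c1; lra.
have q1 : q <= 2^-1 by rewrite ler_pdivrMr //; clear -c1 cs; lra.
have hexp : expR (- (8 * (c + 7) / s)) <= 1 - q.
  by have := expRN2_le q0 q1; rewrite (_ : 2 * q = 8 * (c + 7) / s) // /q; field; rewrite gt_eqF.
apply: (@le_trans _ _ ((1 - q) * wdeg R n m k j)); first by rewrite ler_wpM2r // wdeg_ge0.
rewrite -(ler_pM2r p0) e [(1 - q) * _]mulrC -mulrA; apply: ler_wpM2l; first exact: wdeg_ge0.
have h1 : (c + 7) * (s * (NN n)%:R) <= q * p.
  have e1 : (c + 7) * (s * (NN n)%:R) = q * (d * (NN n)%:R / 4) by rewrite /q -ss; field; rewrite gt_eqF.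
  rewrite e1; apply: ler_wpM2l => //.
  have : d / 2 * (NN n)%:R <= (j.+1%:R - k%:R) * (NN n)%:R.
    by rewrite ler_pM2r // -[j.+1%:R]natr1; clear -hz1; lra.
  by clear -p2; lra.
have h3 : (j%:R - k%:R - d + 1) * (NN n)%:R <= ((c + 3) * s + 1) * (NN n)%:R.
  by rewrite ler_pM2r //; clear -hz2; lra.
have h4 : (NN n)%:R <= s * (NN n)%:R by rewrite ler_peMl //; clear -s8; lra.
by clear -h1 h3 h4 b1; lra.
Qed.

(** The total loss over at most [(2c+9)s] steps, each losing at most a factor [expR (8(c+7)/s)]. The
    length runs from [(c+5)s] below the centre to [(c+3)s] above it, with one more [s] for integer
    parts. *)
Definition window_const (R : realType) (c : R) : R := expR (8 * (c + 7) * (2 * c + 9)).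

Lemma wdeg_window (R : realType) (n m k : nat) (d s c : R) J : scaling n m k d s c ->
  `|J%:R - k%:R - d| <= (c + 2) * s ->
  csum R n m k J <= 1 - (1 + 2 * window_const c * (2 * c + 9))^-1 /\
  wdeg R n m k J <= 2 * window_const c / s.
Proof.
move=> H; rewrite ler_norml => /andP[J1 J2]; have [N0 s8] := scaling_gt0 H.
have c1 := scaling_c H; have cs := scaling_cs H; have ss := scaling_s H; have kd := scaling_k H; have dn := scaling_dn H.
have k0 : 0 <= k%:R :> R by rewrite ler0n.
have s0 : 0 < s by clear -s8; lra.
have d1 : 800 * (c * s) <= d by rewrite -ss expr2 mulrA ler_pM2r.
have cs1 : s <= c * s by rewrite ler_peMl //; exact: ltW.
have e5 : (c + 5) * s = c * s + 5 * s by ring.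
have e2 : (c + 2) * s = c * s + 2 * s by ring.
have e3 : (c + 3) * s = c * s + 3 * s by ring.
have e9 : (2 * c + 9) * s = 2 * (c * s) + 9 * s by ring.
rewrite e2 in J1 J2.
(* Starting [(c+5)s] below the centre puts [j1] before [J] and inside the growth range of [wdeg_up].
   The window length [r] is the integer part of [s]; the bound [r >= s/2] produces the factors [2]
   of the conclusion. *)
have a0 : 0 <= d + k%:R - (c + 5) * s by rewrite e5; clear -d1 cs1 s0 k0; lra.
have /andP[t1 t2] := truncn_itv a0.
have /andP[r1 r2] := truncn_itv (ltW s0).
set j1 := Num.truncn _ in t1 t2; set r := Num.truncn s in r1 r2.
rewrite -natr1 in t2 r2; rewrite e5 in t1 t2.
have r0 : s / 2 <= r%:R by clear -r2 s8; lra.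
have rp : (0 < r)%N by rewrite -(ltr0n R); clear -r0 s8; lra.
have j1J : (j1 <= J)%N by rewrite -(ler_nat R); clear -t1 J1 cs1 s0; lra.
have Jr : (J + r <= n)%N.
  by rewrite -(ler_nat R) natrD; clear -J2 r1 dn kd d1 cs1 s8 k0; lra.
have kj1 : (k <= j1)%N by rewrite -(ler_nat R); clear -t2 d1 cs1 s8; lra.
have jn j : (j < J + r)%N -> (j < n)%N by move=> h; exact: leq_trans Jr.
pose dd := 8 * (c + 7) / s.
have dd0 : 0 <= dd by rewrite divr_ge0 ?(ltW s0) // mulr_ge0 //; clear -c1; lra.
have up j : (j < j1)%N -> wdeg R n m k j * (1 + s^-1) <= wdeg R n m k j.+1.
  move=> hj; apply: (wdeg_up H); first by apply: jn; clear -hj j1J; lia.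
  have : j%:R <= j1%:R :> R by rewrite ler_nat ltnW.
  by clear -t1 cs1 s0; lra.
have step j : (j1 <= j)%N -> (j < J + r)%N -> expR (- dd) * wdeg R n m k j <= wdeg R n m k j.+1.
  move=> h1 h2; apply: (wdeg_down H); [exact: leq_trans h1 | exact: jn | | ].
    have : j1%:R <= j%:R :> R by rewrite ler_nat.
    by clear -t2 d1 cs1 s8; lra.
  have : j%:R <= (J + r)%:R :> R by rewrite ler_nat ltnW.
  by rewrite natrD e3; clear -J2 r1; lra.
have len : dd * (J + r - j1)%:R <= 8 * (c + 7) * (2 * c + 9).
  have -> : 8 * (c + 7) * (2 * c + 9) = dd * ((2 * c + 9) * s).
    by rewrite /dd; field; rewrite gt_eqF.
  apply: ler_wpM2l => //; rewrite natrB; last by clear -j1J; lia.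
  by rewrite natrD e9; clear -J2 r1 t2 s8; lra.
have mid j i : (j1 <= j)%N -> (j <= i)%N -> (i <= J + r)%N -> wdeg R n m k j <= window_const c * wdeg R n m k i.
  move=> h1 h2 h3.
  apply: le_trans (seq_ratio_le dd0 (wdeg_ge0 R n m k) step h1 h2 h3) _.
  by rewrite ler_wpM2r ?wdeg_ge0 // ler_expR.
have E0 : 0 < window_const c by exact: expR_gt0.
have n1 : (1 < n)%N by exact: ltnW (scaling_n H).
have nm : (n <= m)%N by apply: leq_trans (scaling_nm H); rewrite leq_pmull.
have [A B] := window_mass (wdeg_ge0 R n m k) (sum_wdeg R n1 nm (scaling_mN H) (scaling_kn H))
  j1J rp Jr s0 E0 up mid.
have rR : (0 : R) < r%:R by rewrite ltr0n.
split.
  rewrite csumE_nat; last by clear -Jr; lia.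
  apply: (le_trans A); rewrite lerD2l lerN2.
  have c9 : 0 <= 2 * c + 9 by clear -c1; lra.
  have T0 : 0 <= window_const c * (s + (J - j1)%:R) / r%:R.
    by rewrite divr_ge0 // mulr_ge0 ?addr_ge0 // ltW.
  have T1 : window_const c * (s + (J - j1)%:R) / r%:R <= 2 * window_const c * (2 * c + 9).
    rewrite ler_pdivrMr //.
    apply: (@le_trans _ _ (window_const c * ((2 * c + 9) * s))).
      rewrite ler_pM2l // natrB // e9; clear -J2 t2 s8; lra.
    have -> : 2 * window_const c * (2 * c + 9) * r%:R = window_const c * ((2 * c + 9) * (2 * r%:R)) by ring.
    rewrite ler_pM2l //; apply: ler_wpM2l => //; clear -r0; lra.
  have T2 : 0 < 1 + window_const c * (s + (J - j1)%:R) / r%:R by rewrite ltr_pwDl.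
  rewrite lef_pV2 ?posrE //; first by rewrite lerD2l.
  by rewrite (lt_le_trans T2) // lerD2l.
apply: (le_trans B); rewrite ler_pdivrMr // mulrAC ler_pdivlMr // -mulrA mulrCA.
by rewrite ler_pM2l //; clear -r0; lra.
Qed.

(** * Upper tail of the null degree law, and the size of [pair_factor] *)

(** Consecutive null probabilities satisfy [p (j+1) * (j+1) <= d * p j] above the mean, as for a
    Poisson law of mean [d]. Beyond [J] the tail is thus dominated by a geometric series of ratio
    [d/J]. *)
Lemma pdeg_tail (R : realType) (n m k : nat) (d s c : R) J : scaling n m k d s c ->
  d < J%:R -> (J <= n)%N ->
  ptail R n m J <= pdeg R n m J * (J%:R / (J%:R - d)).
Proof.
move=> H dJ Jn; have [N0 s8] := scaling_gt0 H.
case: H => n2 nm mN kn Nn md ss c1 cs kd sk kk dn.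
have nm' : (n <= m)%N by apply: leq_trans nm; rewrite leq_pmull.
have J0 : 0 < J%:R :> R by apply: le_lt_trans dJ; rewrite -ss sqr_ge0.
have d0 : 0 <= d by rewrite -ss sqr_ge0.
have q1 : d / J%:R < 1 by rewrite ltr_pdivrMr // mul1r.
rewrite ptailE_nat; apply: (@le_trans _ _ (pdeg R n m J / (1 - d / J%:R))); last first.
  rewrite (_ : (1 - d / J%:R)^-1 = J%:R / (J%:R - d)) //.
  by field; rewrite !gt_eqF // subr_gt0.
apply: geometric_tail => // [j|j Jj jn]; first exact: pdeg_ge0.
have rec := pdeg_rec R (ltnW n2) nm' mN jn.
have jm : (j <= m)%N by apply: leq_trans nm'; exact: ltnW.
have jn1 : (j <= n.-1)%N by clear -jn; lia.
have hp : n.-1%:R = n%:R - 1 :> R by rewrite -subn1 natrB //; exact: ltnW (ltnW n2).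
have e2 : (NN n - n.-1 - m + j.+1)%:R = (NN n)%:R - (m%:R + n%:R - 2 - j%:R) :> R.
  rewrite natrD !natrB ?hp -?natr1; first by ring.
    by clear -mN; lia.
  by clear -mN; lia.
rewrite e2 [(n.-1 - j)%:R]natrB // hp [(m - j)%:R]natrB // in rec.
have jR : J%:R <= j%:R :> R by rewrite ler_nat.
have jnR : j%:R <= n%:R - 1 :> R by rewrite -hp ler_nat.
have mNR : n%:R - 1 + m%:R <= (NN n)%:R :> R by rewrite -hp -natrD ler_nat.
have ND : (NN n)%:R * d = (n%:R - 1) * m%:R by rewrite Nn md; field.
have m0 : 0 <= m%:R :> R by rewrite ler0n.
have p0 := pdeg_ge0 R n m j; have p0' := pdeg_ge0 R n m j.+1.
move: rec p0 p0'; move: (pdeg R n m j.+1) (pdeg R n m j) => p' p rec p0 p0'.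
set X := _ - _ in rec.
have X0 : 0 < X by rewrite /X; clear -mNR jR J0; lra.
(* The right side minus the left is [(j - d) * (m + n - 1 - j) + d]. *)
have h1 : (n%:R - 1 - j%:R) * (m%:R - j%:R) <= d * X.
  have : 0 <= (j%:R - d) * (m%:R + (n%:R - 1 - j%:R)).
    by apply: mulr_ge0; [clear -jR dJ; lra | clear -m0 jnR; lra].
  rewrite /X; clear -ND d0; lra.
have h2 : p' * j.+1%:R <= d * p.
  rewrite -(ler_pM2r X0) -mulrA rec [d * p]mulrC -mulrA.
  exact: ler_wpM2l.
rewrite mulrAC ler_pdivlMr //; apply: le_trans h2.
by apply: ler_wpM2l => //; rewrite -natr1; clear -jR; lra.
Qed.

(** With [J <= 2d] and [m = nd/2], the edge [uv] and the [2J] steps contribute [32 d/n] each to the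
    exponent, and the ratio at [a = b = 0] contributes [4 d/n]. *)
Lemma pair_factor_le (R : realType) (n m k : nat) (d s c : R) J : scaling n m k d s c ->
  J%:R <= 2 * d -> pair_factor R n m J <= expR (68 * (d / n%:R)).
Proof.
move=> H J2; have [N0 s8] := scaling_gt0 H.
case: H => n2 nm mN kn Nn md ss c1 cs kd sk kk dn.
have n0 : 0 < n%:R :> R by rewrite ltr0n; exact: leq_trans n2.
have s0 : s != 0 by rewrite gt_eqF //; clear -s8; lra.
have d0 : 0 < d by rewrite -ss exprn_even_gt0.
have dneq : d != 0 by rewrite gt_eqF.
have nneq : n%:R != 0 :> R by rewrite gt_eqF.
have m0 : 0 < m%:R :> R by rewrite md divr_gt0 // mulr_gt0.
have hp : n.-1%:R = n%:R - 1 :> R by rewrite -subn1 natrB //; exact: ltnW (ltnW n2).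
have J0 : 0 <= J%:R :> R by rewrite ler0n.
have f1 : 1 + 4 * J%:R ^+ 2 / m%:R <= expR (32 * (d / n%:R)).
  apply: le_trans (expR_ge1Dx _); rewrite lerD2l ler_pdivrMr // md.
  have -> : 32 * (d / n%:R) * (n%:R * d / 2) = 4 * (2 * d) ^+ 2 by field.
  by rewrite ler_pM2l // ler_sqr ?nnegrE // mulr_ge0 // ltW.
have f2 : (1 + 8 / n%:R) ^+ (J + J) <= expR (32 * (d / n%:R)).
  apply: (@le_trans _ _ (expR (8 / n%:R) ^+ (J + J))).
    have h8 : 0 <= 1 + 8 / n%:R :> R by rewrite addr_ge0 // divr_ge0 // ltW.
    by apply: lerXn2r; rewrite ?nnegrE ?expR_ge0 ?expR_ge1Dx.
  rewrite -expRM_natl ler_expR natrD.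
  have -> : 32 * (d / n%:R) = (2 * d + 2 * d) * (8 / n%:R) by field.
  by rewrite ler_wpM2r ?lerD // divr_ge0 // ltW.
set M := (NN n - n.-1).+1.
have Mm : (m < M)%N by rewrite /M; clear -mN; lia.
have ME : M%:R = (NN n)%:R - n%:R + 2 :> R.
  by rewrite /M -natr1 natrB ?hp; [ring | clear -mN; lia].
have n1600 : 1600 <= n%:R :> R.
  by clear -dn kd sk s8; lra.
have nn : 1600 * n%:R <= n%:R * n%:R :> R by rewrite ler_wpM2r // ltW.
have nd : n%:R * (40 * d) <= n%:R * n%:R by rewrite ler_wpM2l // ltW.
have M4 : n%:R * n%:R / 4 <= M%:R :> R.
  by rewrite ME Nn; clear -nn n0; lra.
have M0 : 0 < M%:R :> R by rewrite ltr0n.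
have mM0 : 0 <= m%:R / M%:R :> R by rewrite divr_ge0 // ltW.
have mM : m%:R / M%:R <= 2 * (d / n%:R).
  rewrite ler_pdivrMr // md.
  have -> : n%:R * d / 2 = 2 * (d / n%:R) * (n%:R * n%:R / 4) by field.
  by rewrite ler_wpM2l // mulr_ge0 // divr_ge0 // ltW.
have mM2 : m%:R / M%:R <= 2^-1 :> R.
  by rewrite ler_pdivrMr // md; clear -M4 nd nn n0; lra.
have f3 : M%:R / (M - m)%:R <= expR (4 * (d / n%:R)).
  have -> : M%:R / (M - m)%:R = (1 - m%:R / M%:R)^-1 :> R.
    have h : M%:R - m%:R != 0 :> R by rewrite gt_eqF // subr_gt0 ltr_nat.
    by rewrite natrB ?(ltnW Mm) //; field; rewrite h gt_eqF.
  apply: le_trans (inv_le_expR mM0 mM2) _.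
  by rewrite ler_expR; clear -mM; lra.
have -> : 68 * (d / n%:R) = 32 * (d / n%:R) + 32 * (d / n%:R) + 4 * (d / n%:R) by ring.
rewrite !expRD /pair_factor -/M.
have a1 : 0 <= 1 + 4 * J%:R ^+ 2 / m%:R :> R.
  by rewrite addr_ge0 // divr_ge0 // ?mulr_ge0 ?sqr_ge0 // ltW.
have a2 : 0 <= (1 + 8 / n%:R) ^+ (J + J) :> R.
  by rewrite exprn_ge0 // addr_ge0 // divr_ge0 // ltW.
by apply: ler_pM; [exact: mulr_ge0 | rewrite divr_ge0 | exact: ler_pM |].
Qed.

(** * The explicit error bound at one large [n] *)

Lemma regime_scaling (R : realType) (n m k J : nat) (alpha c : R) :
  regime n m k J alpha c ->
  scaling n m k (2 * m%:R / n%:R) (Num.sqrt (2 * m%:R / n%:R)) c.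
Proof.
move=> H; have [n2 nm mN kn _] := regime_nats H.
have [_ _ _ kd _] := regime_kJ H.
have c1 := regime_c H; have L1 := regime_L_ge40 H; have n0 := regime_n_ge40 H.
have c2 : c <= c ^+ 2 by rewrite expr2 ler_peMl //; clear -c1; lra.
have s1 := regime_s_ge_sqrc H; have Dk := regime_Dk H.
have D0 := density_ge0 R n m; have s0 := density_sqrt_ge0 R n m; have ss := density_sqrtK R n m.
split => //.
- exact: regime_N H.
- exact: regime_mE H.
- by move: s1; move: (Num.sqrt _) => q hq; clear -hq c2; lra.
- rewrite -ler_sqr ?nnegrE ?mulr_ge0 // exprMn ss; apply: le_trans Dk.
  by rewrite ler_wpM2r //; clear -L1; lra.
- exact: regime_kn H.
- exact: regime_D_le_n H.
Qed.

(** The first term bounds the expected number of vertices reaching [J]. In the second, the square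
    bounds [1 / (1 - csum)^2], and the bracket adds the diagonal part [lam J / n] to the pair
    correlation. Only [L] varies with [n]. *)
Definition error_bound (R : realType) (alpha c L : R) : R :=
  8 * window_const c * expR ((c + 2) ^+ 2 / 2 + 10) * expR ((alpha^-1 - 1) * ln L / 2)
  + (1 + 2 * window_const c * (2 * c + 9)) ^+ 2
    * (expR 9 * expR (- (alpha^-1 * ln L / 2)) + (expR (68 / L) - 1)).

Lemma regime_prob_le (R : realType) (n m k J : nat) (alpha c : R) :
  regime n m k J alpha c ->
  Prob R n (P0 R n m) (symdiffAB R alpha n m k) <= error_bound alpha c (ln n%:R) /\
  Prob R n (P1 R n m k) (symdiffAB R alpha n m k) <= error_bound alpha c (ln n%:R).
Proof.
move=> H; have Hs := regime_scaling H.
have [n2 nm mN kn nn8] := regime_nats H.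
have [kJ u0 u2 kd uk] := regime_kJ H.
have [t1 t2] := regime_J_ceil H.
have /andP[lo hi] := regime_lam_bounds H.
have y2 := regime_y_ge H; have g8 := regime_g_ge H.
have c1 := regime_c H; have L1 := regime_L_ge40 H; have n0 := regime_n_ge40 H; have s2 := regime_s_ge800 H.
have gg := regime_sqrg H; have g0 := log_sqrt_ge0 R n; have s0 := density_sqrt_ge0 R n m; have ss := density_sqrtK R n m.
have dn := regime_D_le_n H; have DL := regime_DL_n H;
have D1 := regime_s_le_D H.
have npos : 0 < n%:R :> R by clear -n0; lra.
have enL : expR (ln n%:R) = n%:R :> R by rewrite lnK // posrE.
have Lpos : 0 < ln n%:R :> R by clear -L1; lra.
have llK : expR (ln (ln n%:R)) = ln n%:R :> R by rewrite lnK // posrE.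
have [n1 nm'] : (1 < n)%N /\ (n <= m)%N.
  by split; [exact: ltnW | apply: leq_trans nm; rewrite leq_pmull].
have n00 : (0 < n)%N by exact: ltnW.
have mN' : (m <= NN n)%N by apply: leq_trans mN; rewrite leq_addl.
have sb (e : R) (e0 : 0 <= e) := symdiff_bound mN' n00 nm' e0 (regime_J H).
move: Hs kd u0 u2 uk t1 y2 lo hi gg g0 s0 ss s2 dn DL D1 g8 llK.
rewrite /error_bound; move: (Num.sqrt (2 * m%:R / n%:R)) (Num.sqrt (2 * ln n%:R)) => s g.
move: (2 * m%:R / n%:R) (tstar R alpha n m) => d t.
move: enL Lpos L1; move: (ln n%:R) => L enL Lpos L1; move: (ln L) => l.
set C1 := _ / 2 + 10; set E := window_const c.
move=> Hs kd u0 u2 uk t1 y2 lo hi gg g0 s0 ss s2 dn DL D1 g8 llK.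
have E0 : 0 < E by exact: expR_gt0.
have g8' : 8 <= g by clear -g8 c1; lra.
have gpos : 0 < g by clear -g8'; lra.
have spos : 0 < s by clear -s2; lra.
have dpos : 0 < d by clear -D1 s2; lra.
have J2 : J%:R <= 2 * d by have k0 := ler0n R k; clear -u2 kd k0; lra.
have gs : g * s / 2 <= J%:R - d.
  have : 8 * s <= g * s by rewrite ler_pM2r.
  by clear -t1 y2 spos; lra.
have dJ : d < J%:R by have := mulr_gt0 gpos spos; clear -gs; lra.
have Jn : (2 * J <= n)%N by rewrite -(ler_nat R) natrM; clear -J2 dn dpos; lra.
have Jn1 : (J <= n)%N by apply: leq_trans Jn; rewrite leq_pmull.
have win : `|J%:R - k%:R - d| <= (c + 2) * s.
  have c2 : 0 <= (c + 2) * s by apply: mulr_ge0 => //; clear -c1; lra.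
  rewrite -ler_sqr ?nnegrE // real_normK ?num_real // exprMn ss.
  by rewrite (_ : J%:R - k%:R - d = J%:R - d - k%:R) //; ring.
have [cJ wJ] := wdeg_window Hs win; rewrite -/E in cJ wJ.
set T := 2 * E * (2 * c + 9) in cJ *.
have T0 : 0 < T by rewrite /T mulr_gt0 //; [rewrite mulr_gt0 | clear -c1; lra].
have T1 : 0 < 1 + T by clear -T0; lra.
have Ti : 0 < (1 + T)^-1 by rewrite invr_gt0.
have cJ1 : csum R n m k J < 1 by clear -cJ Ti; lra.
pose eps := expR (68 / L) - 1.
have eps0 : 0 <= eps by rewrite subr_ge0 -expR0 ler_expR divr_ge0 // ltW.
have Hpair (u v : 'I_n) a b : u != v -> (a < J)%N -> (b < J)%N -> (a < n)%N -> (b < n)%N ->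
    (npair m u v a b)%:R / ('C(NN n, m))%:R <= (1 + eps) * (pdeg R n m a * pdeg R n m b).
  move=> uv aJ bJ an bn; apply: le_trans (npair_le R uv n2 nm nn8 Jn aJ bJ an bn) _.
  rewrite ler_wpM2r ?mulr_ge0 ?pdeg_ge0 // /eps addrC subrK.
  apply: le_trans (pair_factor_le Hs J2) _.
  rewrite ler_expR; apply: ler_wpM2l => //.
  by rewrite ler_pdivrMr // mulrC ler_pdivlMr // mulrC.
have lampos : 0 < lam R n m k J by apply: lt_le_trans lo; exact: expR_gt0.
(* The null mass at [J] is [wdeg / lam], of order [expR (alpha^-1 * l / 2) / (s * n)]. Summing the
   tail multiplies it by [J/(J - d) <= 4s/g]: the [s] cancels, and [1/g <= expR (- (l / 2))]
   supplies the [-1] in the exponent [(alpha^-1 - 1) * l / 2]. *)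
have tail : n%:R * ptail R n m J <= 8 * E * expR C1 * expR ((alpha^-1 - 1) * l / 2).
  have h1 : n%:R * pdeg R n m J <= 2 * E / s * expR (alpha^-1 * l / 2 + C1).
    have -> : pdeg R n m J = wdeg R n m k J / lam R n m k J.
      by rewrite /wdeg mulrAC divff ?mul1r // gt_eqF.
    rewrite mulrA ler_pdivrMr //.
    apply: (@le_trans _ _ (2 * E / s * n%:R)); first by rewrite mulrC ler_pM2r.
    rewrite -[X in _ <= X]mulrA; apply: ler_wpM2l.
      by rewrite divr_ge0 // mulr_ge0 // ltW.
    apply: (@le_trans _ _ (expR (alpha^-1 * l / 2 + C1) * expR (L - alpha^-1 * l / 2 - C1))).
      by rewrite -expRD -enL ler_expR; clear; lra.
    by rewrite ler_pM2l // expR_gt0.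
  have h2 : J%:R / (J%:R - d) <= 4 * s / g.
    have Jd : 0 < J%:R - d by rewrite subr_gt0.
    rewrite ler_pdivrMr //; apply: (le_trans J2).
    have -> : 2 * d = 4 * s / g * (g * s / 2) by rewrite -ss; field; rewrite gt_eqF.
    by rewrite ler_wpM2l // divr_ge0 ?mulr_ge0 // ltW.
  have h3 : expR (l / 2) <= g.
    rewrite -ler_sqr ?nnegrE ?expR_ge0 // gg -expRM_natl.
    by rewrite (_ : 2 * (l / 2) = l) ?llK; [clear -Lpos; lra | field].
  have h4 : 1 / g <= expR (- (l / 2)).
    by rewrite div1r expRN lef_pV2 ?posrE ?expR_gt0.
  apply: (@le_trans _ _ (n%:R * pdeg R n m J * (J%:R / (J%:R - d)))).
    by rewrite -mulrA ler_pM2l //; exact: pdeg_tail Hs dJ Jn1.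
  apply: (@le_trans _ _ (2 * E / s * expR (alpha^-1 * l / 2 + C1) * (4 * s / g))).
    apply: ler_pM => //; first by rewrite mulr_ge0 ?pdeg_ge0 // ltW.
    by rewrite divr_ge0 ?ler0n // ltW // subr_gt0.
  have -> : 2 * E / s * expR (alpha^-1 * l / 2 + C1) * (4 * s / g)
     = 8 * E * expR C1 * (expR (alpha^-1 * l / 2) * (1 / g)).
    by rewrite expRD; field; rewrite !gt_eqF.
  have -> : expR ((alpha^-1 - 1) * l / 2) = expR (alpha^-1 * l / 2) * expR (- (l / 2)).
    by rewrite -expRD; congr expR; ring.
  apply: ler_wpM2l; first by rewrite !mulr_ge0 ?expR_ge0 // ltW.
  by rewrite ler_wpM2l ?expR_ge0.
have mid : (lam R n m k J / n%:R + eps) / (1 - csum R n m k J) ^+ 2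
   <= (1 + T) ^+ 2 * (expR 9 * expR (- (alpha^-1 * l / 2)) + eps).
  have h1 : lam R n m k J / n%:R <= expR 9 * expR (- (alpha^-1 * l / 2)).
    rewrite ler_pdivrMr // -enL -!expRD; apply: (le_trans hi).
    by rewrite ler_expR; clear; lra.
  have q0 : 0 < 1 - csum R n m k J by rewrite subr_gt0.
  have h2 : ((1 - csum R n m k J) ^+ 2)^-1 <= (1 + T) ^+ 2.
    rewrite -[_ ^+ 2 in X in _ <= X]invrK lef_pV2 ?posrE ?invr_gt0 ?exprn_gt0 //.
    rewrite -exprVn ler_sqr ?nnegrE ?(ltW Ti) ?(ltW q0) //; clear -cJ; lra.
  rewrite mulrC; apply: ler_pM => //.
  - by rewrite invr_ge0 exprn_ge0 // ltW.
  - by rewrite addr_ge0 // divr_ge0 // ltW.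
  - by rewrite lerD2r.
have [B1 B2] := sb k eps eps0 Hpair cJ1.
by split; [apply: (le_trans B1) | apply: (le_trans B2)]; apply: lerD.
Qed.

(** * From the hypotheses on [k] and [m] to the numerical regime *)

(** Rounding [m] changes [2 L D] by at most [4L/n <= 1], so [k^2 - 2 L D] is [- k^2 q] up to [1].
    Dividing by [k + sqrt (2L) * s] and using [k / sqrt L <= 2s] bounds the distance from [k] to
    [sqrt (2L) * s] by [2 |gamma| s + 1], which explains [c]. *)
Lemma regime_arith (R : realType) (n m k L gamma c : R) :
  c = 2 * `|gamma| + 2 -> 40 * c ^+ 2 <= L -> 160 * L <= k -> k ^+ 2 <= n ->
  `|m - k ^+ 2 * n / (4 * L) * (1 + gamma / Num.sqrt L)| < 1 -> 0 <= m ->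
  let D := 2 * m / n in
  [/\ k ^+ 2 <= 4 * L * D, L * D <= k ^+ 2 &
     `|k - Num.sqrt (2 * L) * Num.sqrt D| <= c * Num.sqrt D].
Proof.
move=> cE LB kL kn hm m0 D.
have g0 : 0 <= `|gamma| by exact: normr_ge0.
have c2 : 2 <= c by rewrite cE; clear -g0; lra.
have c3 : 2 * c <= c ^+ 2 by rewrite expr2 ler_wpM2r //; clear -c2; lra.
have L1 : 1 <= L by clear -c2 c3 LB; lra.
have k1 : 160 <= k by clear -L1 kL; lra.
have kk : 160 * k <= k ^+ 2 by rewrite expr2 ler_wpM2r //; clear -k1; lra.
have n0 : 0 < n by clear -kk kn k1; lra.
have L0 : 0 < L by clear -L1; lra.
have sL0 : 0 < Num.sqrt L by rewrite sqrtr_gt0.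
have sLL : Num.sqrt L ^+ 2 = L by rewrite sqr_sqrtr // ltW.
have sL : 6 * c <= Num.sqrt L.
  have c0 : 0 <= 6 * c by clear -c2; lra.
  rewrite -ler_sqr ?nnegrE ?sqrtr_ge0 // sLL exprMn; clear -LB c3 c2; lra.
have D0 : 0 <= D by rewrite divr_ge0 ?mulr_ge0 // ltW.
move: hm; set q := gamma / Num.sqrt L => hm.
have q1 : `|q| <= 4^-1.
  rewrite normrM normfV (gtr0_norm sL0) ler_pdivrMr //.
  by clear -sL cE c2 g0; lra.
have qB : - 4^-1 <= q <= 4^-1 by rewrite -ler_norml.
have hX : `|2 * L * D - k ^+ 2 * (1 + q)| <= 1.
  have -> : 2 * L * D - k ^+ 2 * (1 + q)
     = (4 * L / n) * (m - k ^+ 2 * n / (4 * L) * (1 + q)).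
    by rewrite /D; field; rewrite !gt_eqF.
  have L4 : 0 <= 4 * L / n by rewrite divr_ge0 ?mulr_ge0 // ltW.
  rewrite normrM (ger0_norm L4) -[X in _ <= X]mulr1; apply: ler_pM => //; last exact: ltW.
  by rewrite ler_pdivrMr // mul1r; clear -kk kn kL k1; lra.
have X1 : k ^+ 2 * (3 / 4) - 1 <= 2 * L * D.
  have : k ^+ 2 * (3 / 4) <= k ^+ 2 * (1 + q).
    by rewrite ler_wpM2l ?sqr_ge0 //; case/andP: qB; clear; lra.
  by move: hX; rewrite ler_norml => /andP[h _] h'; clear -h h'; lra.
have X2 : 2 * L * D <= k ^+ 2 * (5 / 4) + 1.
  have : k ^+ 2 * (1 + q) <= k ^+ 2 * (5 / 4).
    by rewrite ler_wpM2l ?sqr_ge0 //; case/andP: qB; clear; lra.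
  by move: hX; rewrite ler_norml => /andP[_ h] h'; clear -h h'; lra.
have A1 : k ^+ 2 <= 4 * L * D by clear -X1 kk k1; lra.
split=> //; first by clear -X2 kk k1; lra.
set s := Num.sqrt D; set u := Num.sqrt (2 * L) * s.
have s0 : 0 <= s by exact: sqrtr_ge0.
have ss : s ^+ 2 = D by rewrite sqr_sqrtr.
have u0 : 0 <= u by rewrite mulr_ge0 ?sqrtr_ge0.
have uu : u ^+ 2 = 2 * L * D by rewrite exprMn ss sqr_sqrtr // mulr_ge0 // ltW.
have kp : 0 < k by clear -k1; lra.
have s1 : 1 <= s.
  rewrite -ler_sqr ?nnegrE // expr1n ss.
  have : 4 * L * 1 <= 4 * L * D by clear -A1 kk kL k1 L1; lra.
  by rewrite ler_pM2l // mulr_gt0.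
have h1 : `|k - u| * k <= k ^+ 2 * `|q| + 1.
  apply: (@le_trans _ _ (`|k - u| * (k + u))); first by rewrite ler_wpM2l // lerDl.
  have ku : 0 <= k + u by rewrite addr_ge0 // ltW.
  rewrite -(ger0_norm ku) -normrM -subr_sqr uu.
  have -> : k ^+ 2 - 2 * L * D = - (k ^+ 2 * q) - (2 * L * D - k ^+ 2 * (1 + q)) by ring.
  apply: (le_trans (ler_normB _ _)); rewrite normrN normrM (ger0_norm (sqr_ge0 k)).
  by rewrite lerD2l.
have h2 : `|k - u| <= k * `|q| + 1.
  rewrite -(ler_pM2r kp); apply: (le_trans h1).
  have -> : (k * `|q| + 1) * k = k ^+ 2 * `|q| + k by ring.
  by rewrite lerD2l; clear -k1; lra.
have h3 : k / Num.sqrt L <= 2 * s.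
  rewrite ler_pdivrMr // -ler_sqr ?nnegrE ?(ltW kp) //; last first.
    by rewrite !mulr_ge0 // ltW.
  by rewrite !exprMn ss sLL; clear -A1; lra.
have h4 : k * `|q| = `|gamma| * (k / Num.sqrt L).
  by rewrite normrM normfV (gtr0_norm sL0); ring.
have h5 : `|gamma| * (k / Num.sqrt L) <= `|gamma| * (2 * s) by rewrite ler_wpM2l.
apply: (le_trans h2); rewrite h4 cE.
have -> : (2 * `|gamma| + 2) * s = `|gamma| * (2 * s) + 2 * s by ring.
by clear -h5 s1; lra.
Qed.

Lemma regime_intro (R : realType) (n m k : nat) (gamma alpha c : R) :
  1 < alpha -> c = 2 * `|gamma| + 2 -> 40 * c ^+ 2 <= ln n%:R ->
  40 * c ^+ 2 * ln n%:R ^+ 2 <= k%:R -> k%:R ^+ 2 <= n%:R :> R ->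
  `|m%:R - m_target R gamma n k| < 1 ->
  exists J, regime n m k J alpha c.
Proof.
move=> a1 cE LB kL kn; rewrite /m_target.
have [J HJ] : exists J : nat, forall j : nat, (tstar R alpha n m <= j%:R) = (J <= j)%N.
  have ex : exists j : nat, tstar R alpha n m <= j%:R.
    exists (Num.truncn `|tstar R alpha n m|).+1; apply: le_trans (ler_norm _) _.
    by have /andP[_ /ltW] := truncn_itv (normr_ge0 (tstar R alpha n m)).
  exists (ex_minn ex) => j; case: ex_minnP => J hJ minJ; apply/idP/idP => [|Jj]; first exact: minJ.
  by apply: le_trans hJ _; rewrite ler_nat.
move: LB kL; set L := ln n%:R => LB kL hm.
have g0 : 0 <= `|gamma| by exact: normr_ge0.
have c2 : 2 <= c by rewrite cE; clear -g0; lra.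
have cc : 4 <= c ^+ 2 by have := ler_pM (ltac:(lra) : 0 <= 2 :> R) (ltac:(lra) : 0 <= 2 :> R) c2 c2; rewrite -expr2; lra.
have L1 : 160 <= L by clear -cc LB; lra.
have LL : L <= L ^+ 2 by rewrite expr2 ler_peMl //; clear -L1; lra.
have k4 : 160 * L <= k%:R.
  apply: le_trans kL; apply: (@le_trans _ _ (160 * L ^+ 2)); first by rewrite ler_pM2l.
  by rewrite ler_wpM2r ?sqr_ge0 //; clear -cc; lra.
have L0 : 0 <= L by clear -L1; lra.
have [A1 A2 A3] := regime_arith cE LB k4 kn hm (ler0n R m).
by exists J; split => //; clear -c2; lra.
Qed.

(** * Limits and conclusion *)

Local Open Scope classical_set_scope.

Lemma cvg_expRN (R : realType) (f : nat -> R) (a : R) : 0 < a ->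
  f @ \oo --> +oo -> (fun n => expR (- (a * f n))) @ \oo --> (0 : R).
Proof.
move=> a0 fy; apply: (@cvg_comp _ _ _ (fun n => a * f n) (fun x => expR (- x)) _ _ _ _ (@cvgr_expR R)).
apply/cvgryPge => A; move/cvgryPge: fy => /(_ (A / a)); apply: filterS => n.
by rewrite ler_pdivrMr // mulrC.
Qed.

Lemma cvg_ln_pinfty (R : realType) (f : nat -> R) :
  f @ \oo --> +oo -> (fun n => ln (f n)) @ \oo --> +oo.
Proof.
move=> fy; apply/cvgryPge => A; move/cvgryPge: fy => /(_ (expR A)); apply: filterS => n h.
by rewrite -[A]expRK ler_ln // posrE ?expR_gt0 // (lt_le_trans _ h) ?expR_gt0.
Qed.

Lemma cvg_natr_pinfty (R : realType) : (fun n : nat => n%:R : R) @ \oo --> +oo.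
Proof. by apply/cvgryPge => A; exact: nbhs_infty_ger. Qed.

Lemma error_bound_cvg (R : realType) (alpha c : R) (f : nat -> R) : 1 < alpha ->
  f @ \oo --> +oo -> (fun n => error_bound alpha c (f n)) @ \oo --> (0 : R).
Proof.
move=> a1 fy; have a0 : 0 < alpha^-1 by rewrite invr_gt0; lra.
have a2 : alpha^-1 < 1 by rewrite invf_lt1 //; lra.
have ly := cvg_ln_pinfty fy.
have l1 : (fun n => expR ((alpha^-1 - 1) * ln (f n) / 2)) @ \oo --> (0 : R).
  (* Here [alpha > 1] is decisive: at [alpha = 1] this bound on the number of exceedances would stay
     constant. *)
  have h : 0 < (1 - alpha^-1) / 2 by lra.
  have := cvg_expRN h ly; set F := (X in X @ _ --> _); set G := (X in _ -> X @ _ --> _).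
  suff -> : F = G by [].
  by apply/funext => n; rewrite /F /G; congr expR; field; rewrite gt_eqF //; lra.
have l2 : (fun n => expR (- (alpha^-1 * ln (f n) / 2))) @ \oo --> (0 : R).
  have h : 0 < alpha^-1 / 2 by lra.
  have := cvg_expRN h ly; set F := (X in X @ _ --> _); set G := (X in _ -> X @ _ --> _).
  suff -> : F = G by [].
  by apply/funext => n; rewrite /F /G; congr expR; field; rewrite gt_eqF //; lra.
have l3 : (fun n => expR (68 / f n) - 1) @ \oo --> (0 : R).
  have v : (fun n => (f n)^-1) @ \oo --> (0 : R).
    apply/gtr0_cvgV0; last exact: fy.
    by move/cvgryPgt: fy; apply.
  have v2 : (fun n => 68 / f n) @ \oo --> (0 : R).
    by rewrite -(mulr0 68); apply: cvgMl_tmp.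
  have v3 : (fun n => expR (68 / f n)) @ \oo --> (1 : R).
    by have := @cvg_comp _ _ _ (fun n => 68 / f n) (@expR R) _ _ _ v2 (@continuous_expR R 0); rewrite expR0.
  by rewrite -(subrr 1); apply: cvgB => //; exact: cvg_cst.
rewrite /error_bound.
set C1 := _ * expR _; set C2 := _ ^+ 2.
have -> : (0 : R) = C1 * 0 + C2 * (expR 9 * 0 + 0) by ring.
apply: cvgD; first exact: cvgMl_tmp.
by apply: cvgMr; apply: cvgD => //; exact: cvgMl_tmp.
Unshelve. all: by end_near.
Qed.

Lemma Prob_ge0 (R : realType) (n : nat) (P : graph n -> R) E :
  (forall G, 0 <= P G) -> 0 <= Prob R n P E.
Proof. by move=> P0; apply: sumr_ge0. Qed.

Lemma P0_ge0 (R : realType) (n m : nat) (G : graph n) : 0 <= P0 R n m G.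
Proof. by rewrite /P0; case: ifP => // _; rewrite invr_ge0. Qed.

Lemma P1_ge0 (R : realType) (n m k : nat) (G : graph n) : 0 <= P1 R n m k G.
Proof.
apply: sumr_ge0 => v _; apply: sumr_ge0 => S _.
by rewrite !mulr_ge0 ?invr_ge0 //; case: ifP; rewrite ?invr_ge0.
Qed.

Unset Implicit Arguments.

Theorem mainTheorem2 (R : realType) (gamma alpha : R) (k m : nat -> nat) :
  1 < alpha ->
  ((fun n : nat => (k n)%:R / (ln (n%:R : R)) ^+ 2) @ \oo --> +oo) ->
  ((fun n : nat => (k n)%:R / Num.sqrt (n%:R : R)) @ \oo --> (0 : R)) ->
  (\forall n \near \oo, `|(m n)%:R - m_target R gamma n (k n)| < 1) ->
  ((fun n : nat => Prob R n (P0 R n (m n)) (symdiffAB R alpha n (m n) (k n))) @ \oo --> (0 : R))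
  /\
  ((fun n : nat => Prob R n (P1 R n (m n) (k n)) (symdiffAB R alpha n (m n) (k n))) @ \oo --> (0 : R)).
Proof.
move=> a1 kL kn hm.
pose c : R := 2 * `|gamma| + 2.
have bound : \forall n \near \oo,
    Prob R n (P0 R n (m n)) (symdiffAB R alpha n (m n) (k n)) <= error_bound alpha c (ln n%:R) /\
    Prob R n (P1 R n (m n) (k n)) (symdiffAB R alpha n (m n) (k n)) <= error_bound alpha c (ln n%:R).
  have lnA : \forall n \near \oo, 40 * c ^+ 2 <= ln (n%:R : R).
    by move/cvgryPge: (cvg_ln_pinfty (@cvg_natr_pinfty R)); exact.
  have ln1 : \forall n \near \oo, 1 <= ln (n%:R : R).
    by move/cvgryPge: (cvg_ln_pinfty (@cvg_natr_pinfty R)); exact.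
  have kA : \forall n \near \oo, 40 * c ^+ 2 <= (k n)%:R / (ln (n%:R : R)) ^+ 2.
    by move/cvgryPge: kL; exact.
  have kB : \forall n \near \oo, `|(k n)%:R / Num.sqrt (n%:R : R)| <= 1.
    by move/cvgr0Pnorm_le: kn; apply; exact: ltr01.
  near=> n.
  have h1 : 1 <= ln (n%:R : R) by near: n; exact: ln1.
  have h2 : 40 * c ^+ 2 <= ln (n%:R : R) by near: n; exact: lnA.
  have h3 : 40 * c ^+ 2 <= (k n)%:R / (ln (n%:R : R)) ^+ 2 by near: n; exact: kA.
  have h4 : `|(k n)%:R / Num.sqrt (n%:R : R)| <= 1 by near: n; exact: kB.
  have h5 : `|(m n)%:R - m_target R gamma n (k n)| < 1 by near: n; exact: hm.
  have n0 : (0 : R) < n%:R by near: n; exact: nbhs_infty_gtr.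
  have L2 : 0 < (ln (n%:R : R)) ^+ 2 by rewrite exprn_gt0 // (lt_le_trans ltr01).
  rewrite ler_pdivlMr // in h3.
  have kk : (k n)%:R ^+ 2 <= n%:R :> R.
    have sn : 0 < Num.sqrt (n%:R : R) by rewrite sqrtr_gt0.
    have := le_trans (ler_norm _) h4; rewrite ler_pdivrMr // mul1r => h.
    by rewrite -[leRHS](sqr_sqrtr (ltW n0)) ler_sqr ?nnegrE // ltW.
  have [J HJ] := regime_intro a1 erefl h2 h3 kk h5.
  exact: regime_prob_le HJ.
have err0 := error_bound_cvg c a1 (cvg_ln_pinfty (@cvg_natr_pinfty R)).
split.
- apply: (squeeze_cvgr _ (cvg_cst 0) err0).
  apply: filterS bound => n [h _]; rewrite h andbT.
  by apply: Prob_ge0 => G; exact: P0_ge0.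
- apply: (squeeze_cvgr _ (cvg_cst 0) err0).
  apply: filterS bound => n [_ h]; rewrite h andbT.
  by apply: Prob_ge0 => G; exact: P1_ge0.
Unshelve. all: by end_near.
Qed.
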